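(* Let $A$ be an accretive operator in a Hilbert space $H$. Then $A$ can be generated by an accretive form if and only if $\operatorname{rg}(I+A)$ is an operator range in $H$. Moreover, if $\operatorname{rg}(I+A)$ is an operator range in $H$ and the orthogonal complement of $D(A)$ in $H$ is zero or infinite dimensional, then $A$ can be generated by an embedded accretive form.
   Context: Hilbert spaces are complex; inner products and sesquilinear forms are linear in the first and antilinear in the second argument. $\mathcal{L}(V,H)$ denotes the bounded linear operators from $V$ to $H$, $\mathcal{L}(H)=\mathcal{L}(H,H)$; $\operatorname{rg}$ denotes the range. An operator in $H$ is a linear map $A\colon D(A)\to H$ defined on a linear subspace $D(A)\subset H$ (not necessarily dense, $A$ not necessarily closed). It is accretive if $\operatorname{Re}(Ax\mid x)_H\ge 0$ for all $x\in D(A)$. A subspace $\mathcal{R}$ of $H$ is an operator range in $H$ if there exists $R\in\mathcal{L}(H)$ with $\mathcal{R}=\operatorname{rg}R$. Let $V$ be a Hilbert space, $\mathfrak{a}\colon V\times V\to\mathbb{C}$ a continuous sesquilinear form that is accretive, i.e. $\operatorname{Re}\mathfrak{a}(u,u)\ge 0$ for all $u\in V$, and $j\in\mathcal{L}(V,H)$ with dense range (not necessarily injective). Define $D_j(\mathfrak{a})=\{u\in V : \text{there exists } f\in H \text{ such that } \mathfrak{a}(u,v)=(f\mid j(v))_H \text{ for all } v\in V\}$. We say that $A$ is associated with $(\mathfrak{a},j)$ if $D(A)=j(D_j(\mathfrak{a}))$ and $\mathfrak{a}(u,v)=(Aj(u)\mid j(v))_H$ for all $u\in D_j(\mathfrak{a})$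 and $v\in V$. $A$ can be generated by an accretive form if there exist a Hilbert space $V$, a map $j\in\mathcal{L}(V,H)$ with dense range and a continuous accretive sesquilinear form $\mathfrak{a}\colon V\times V\to\mathbb{C}$ such that $A$ is associated with $(\mathfrak{a},j)$. If $j$ can in addition be chosen injective, $A$ can be generated by an embedded accretive form. *)

(* Defs.v *)
From HB Require Import structures.
From mathcomp Require Import all_boot all_order all_algebra.
From mathcomp Require Import complex.
From mathcomp Require Import all_classical all_reals all_analysis.

Set Implicit Arguments.
Unset Strict Implicit.
Unset Printing Implicit Defensive.

Import Order.TTheory GRing.Theory Num.Theory.
Import numFieldNormedType.Exports.

Local Open Scope classical_set_scope.
Local Open Scope ring_scope.
Local Open Scope complex_scope.

(* The form [hdot] is linear in its first argument and antilinear in its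
   second one. As usual for normed modules over [R[i]], the norm takes its
   values in [R[i]]; [hdotE] says that it is the norm induced by [hdot]. *)
HB.mixin Record CompleteNormedModule_isHilbert (R : realType) (H : Type)
    & CompleteNormedModule R[i] H := {
  hdot : {dot H for (@Num.conj R[i])};
  hdotE : forall x : H, hdot x x = `|x| ^+ 2
}.

#[short(type="hilbertType")]
HB.structure Definition Hilbert (R : realType) :=
  {H of CompleteNormedModule R[i] H & CompleteNormedModule_isHilbert R H}.

Definition bounded_operator (R : realType) (V H : hilbertType R)
    (T : {linear V -> H}) : Prop :=
  exists M : R[i], forall x, `|T x| <= M * `|x|.

Definition operator_range (R : realType) (H : hilbertType R) (S : set H) :=
  exists T : {linear H -> H}, bounded_operator T /\ S = range T.

(* An operator is only defined on the subspace [odom A]: the values of the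
   total function [oper A] outside [odom A] are irrelevant. *)
Record operator (R : realType) (H : hilbertType R) := Operator {
  odom : set H;
  oper :> H -> H;
  odom0 : odom 0;
  odom_linear : forall c x y, odom x -> odom y -> odom (c *: x + y);
  oper_linear : forall c x y, odom x -> odom y ->
    oper (c *: x + y) = c *: oper x + oper y
}.

Definition accretive (R : realType) (H : hilbertType R) (A : operator H) :=
  forall x, odom A x -> 0 <= complex.Re (hdot (A x) x).

(* rg (I + A) *)
Definition range_id_plus (R : realType) (H : hilbertType R)
    (A : operator H) : set H := [set x + A x | x in odom A].

Definition orthogonal_complement (R : realType) (H : hilbertType R)
    (S : set H) : set H := [set y | forall x, S x -> hdot y x = 0].

Definition finite_dimensional (K : fieldType) (V : lmodType K) (S : set V) :=
  exists (n : nat) (e : 'I_n -> V), (forall i, S (e i)) /\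
    forall x, S x -> exists c : 'I_n -> K, x = \sum_(i < n) c i *: e i.

Definition sesquilinear_form (R : realType) (V : lmodType R[i]) :=
  {bilinear V -> V -> R[i] | *%R & Num.conj \; *%R}.

Definition continuous_form (R : realType) (V : hilbertType R)
    (a : sesquilinear_form V) :=
  continuous (fun p : V * V => (a p.1 p.2 : R[i]^o)).

Definition accretive_form (R : realType) (V : hilbertType R)
    (a : sesquilinear_form V) := forall u, 0 <= complex.Re (a u u).

(* D_j(a) *)
Definition form_domain (R : realType) (V H : hilbertType R)
    (a : sesquilinear_form V) (j : {linear V -> H}) : set V :=
  [set u | exists f : H, forall v, a u v = hdot f (j v)].

Definition associated (R : realType) (V H : hilbertType R)
    (A : operator H) (a : sesquilinear_form V) (j : {linear V -> H}) :=
  odom A = j @` form_domain a j /\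
  forall u v, form_domain a j u -> a u v = hdot (A (j u)) (j v).

Definition generating_form (R : realType) (V H : hilbertType R)
    (A : operator H) (a : sesquilinear_form V) (j : {linear V -> H}) :=
  [/\ bounded_operator j, dense (range j), continuous_form a,
      accretive_form a & associated A a j].

Definition generated_by_accretive_form (R : realType) (H : hilbertType R)
    (A : operator H) :=
  exists (V : hilbertType R) (j : {linear V -> H}) (a : sesquilinear_form V),
    generating_form A a j.

Definition generated_by_embedded_accretive_form (R : realType)
    (H : hilbertType R) (A : operator H) :=
  exists (V : hilbertType R) (j : {linear V -> H}) (a : sesquilinear_form V),
    injective j /\ generating_form A a j.

(* Main.v *)
(* If A is associated with (a, j) and B is the operator of the form
   a + (j . | j .) on V, then rg (I + A) = {f | j^* f in rg B}; the preimage of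
   an operator range is an operator range.

   Conversely let rg (I + A) = rg R, let J = (I + A)^-1 R and T = A J = R - J, let
   E be the orthogonal complement of D(A), and let (T_n) be bounded operators from
   a Hilbert space F to E. On pairs (w, z) with z a square-summable sequence in F
   put j (w, z) = J w + j1 z with j1 z = sum_n 4^-n T_n z_n, and
     a ((w, z), v) = (T w | j v) - (j1 z | T w') + sum_n 4^-n (z_n | z'_n)
   for v = (w', z'). In Re a (u, u) the terms coupling w and z cancel. If a (u, .)
   is represented by f, then z_n = T_n^* x for all n with x = f - T w; as soon as
   the sequence (T_n^* x) is square-summable only for x orthogonal to E, this forces
   z = 0 and f = T w, so that (a, j) generates A.

   The constant family T_n = P_E has this property, but j is then not injective. If
   E is infinite-dimensional, a maximal family of mutually orthogonal orthonormal
   sequences in E leaves only a finite-dimensional part of E uncovered. Let F be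
   spanned by the first terms s_0 of these sequences and let U_n s_0 = s_n. Then
   T_n = U_n - W_n works, where W_n takes infinitely often each of the values U_k
   and (. | g) f, with f in a spanning set of the uncovered part, and W_n = U_k only
   for k < n. *)
From HB Require Import structures.
Require Import Defs.
From mathcomp Require Import all_boot all_order all_algebra.
From mathcomp Require Import complex ring lra zify.
From mathcomp Require Import all_classical all_reals all_analysis.

Set Implicit Arguments.
Unset Strict Implicit.
Unset Printing Implicit Defensive.

Import Order.TTheory GRing.Theory Num.Theory.
Import numFieldNormedType.Exports.

Local Open Scope classical_set_scope.
Local Open Scope ring_scope.
Local Open Scope complex_scope.

Local Notation re := (@complex.Re _).
Local Notation im := (@complex.Im _).
Local Notation cabs := ComplexField.Normc.normc.

(** * Complex numbers and inner products *)

Section ComplexFacts.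
Context {R : realType}.
Implicit Types c d : R[i].

Lemma conjE c : Num.conj c = (re c -i* im c).
Proof. by case: c. Qed.

Lemma absE c : `|c| = (cabs c)%:C.
Proof. by []. Qed.

Lemma reD c d : re (c + d) = re c + re d.
Proof. by case: c; case: d. Qed.

Lemma reN c : re (- c) = - re c.
Proof. by case: c. Qed.

Lemma reM c d : re (c * d) = re c * re d - im c * im d.
Proof. by case: c; case: d. Qed.

Lemma re_conj c : re (Num.conj c) = re c.
Proof. by case: c. Qed.

Lemma cabs_ge0 c : 0 <= cabs c.
Proof. by case: c => a b; exact: sqrtr_ge0. Qed.

Lemma cabs2 c : cabs c ^+ 2 = re c ^+ 2 + im c ^+ 2.
Proof. by case: c => a b /=; rewrite sqr_sqrtr// addr_ge0// sqr_ge0. Qed.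

Lemma cabs_conj c : cabs (Num.conj c) = cabs c.
Proof. by case: c => a b /=; rewrite sqrrN. Qed.

Lemma re_le_cabs c : re c <= cabs c.
Proof.
apply: le_trans (ler_norm _) _; case: c => a b /=.
by rewrite -sqrtr_sqr ler_wsqrtr// lerDl sqr_ge0.
Qed.

Lemma cabsR (x : R) : cabs x%:C = `|x|.
Proof. by rewrite /= expr0n addr0 sqrtr_sqr. Qed.

Lemma cabsD c d : cabs (c + d) <= cabs c + cabs d.
Proof. exact: le_normcD. Qed.

Lemma cabs0_eq0 c : cabs c = 0 -> c = 0.
Proof. exact: ComplexField.Normc.eq0_normc. Qed.

End ComplexFacts.

Section Basics.
Context {R : realType} {H : hilbertType R}.
Implicit Types (x y z : H) (c : R[i]).

(** The norm takes values in [R[i]]; it is a nonnegative real, so its real part carries all the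
    information and estimates can be made in [R]. *)
Definition nrm x : R := re `|x|.

Lemma normE x : `|x| = (nrm x)%:C.
Proof. by rewrite RRe_real// ger0_real. Qed.

Lemma nrm_ge0 x : 0 <= nrm x.
Proof. by rewrite -ler0c -normE. Qed.

Lemma nrmD x y : nrm (x + y) <= nrm x + nrm y.
Proof. by have := ler_normD x y; rewrite !normE -rmorphD lecR. Qed.

Lemma nrmN x : nrm (- x) = nrm x.
Proof. by rewrite /nrm normrN. Qed.

Lemma nrmB x y : nrm (x - y) <= nrm x + nrm y.
Proof. by rewrite -(nrmN y) nrmD. Qed.

Lemma nrmC x y : nrm (x - y) = nrm (y - x).
Proof. by rewrite -nrmN opprB. Qed.

Lemma nrm_dist z x y : nrm (x - y) <= nrm (x - z) + nrm (y - z).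
Proof. by rewrite (nrmC y) (le_trans _ (nrmD _ _))// addrA subrK. Qed.

Lemma nrmZ c x : nrm (c *: x) = cabs c * nrm x.
Proof. by rewrite /nrm normrZ normE absE -rmorphM. Qed.

Lemma nrm0 : nrm (0 : H) = 0.
Proof. by rewrite /nrm normr0. Qed.

Lemma nrm_eq0 x : nrm x = 0 -> x = 0.
Proof. by move=> h; apply/normr0_eq0; rewrite normE h. Qed.

Lemma hdotDl x y z : hdot (x + y) z = hdot x z + hdot y z.
Proof. exact: linearDl. Qed.
Lemma hdotDr x y z : hdot z (x + y) = hdot z x + hdot z y.
Proof. exact: linearDr. Qed.
Lemma hdotNl x z : hdot (- x) z = - hdot x z.
Proof. exact: linearNl. Qed.
Lemma hdotNr x z : hdot z (- x) = - hdot z x.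
Proof. exact: linearNr. Qed.
Lemma hdotBl x y z : hdot (x - y) z = hdot x z - hdot y z.
Proof. exact: linearBl. Qed.
Lemma hdotBr x y z : hdot z (x - y) = hdot z x - hdot z y.
Proof. exact: linearBr. Qed.
Lemma hdotZl c x z : hdot (c *: x) z = c * hdot x z.
Proof. exact: linearZl_LR. Qed.
Lemma hdotZr c x z : hdot z (c *: x) = Num.conj c * hdot z x.
Proof. exact: linearZr_LR. Qed.
Lemma hdot0l z : hdot 0 z = 0.
Proof. exact: linear0l. Qed.
Lemma hdot0r z : hdot z 0 = 0.
Proof. exact: linear0r. Qed.

Lemma hdotC x y : hdot x y = Num.conj (hdot y x).
Proof. by rewrite (hermC hdot) mul1r. Qed.

Lemma hdotxx x : hdot x x = (nrm x ^+ 2)%:C.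
Proof. by rewrite hdotE normE -rmorphXn. Qed.

Definition rdot x y : R := re (hdot x y).

Lemma rdotC x y : rdot x y = rdot y x.
Proof. by rewrite /rdot hdotC re_conj. Qed.

Lemma rdotxx x : rdot x x = nrm x ^+ 2.
Proof. by rewrite /rdot hdotxx. Qed.

Lemma nrmD2 x y : nrm (x + y) ^+ 2 = nrm x ^+ 2 + 2 * rdot x y + nrm y ^+ 2.
Proof.
rewrite -!rdotxx /rdot hdotDl !hdotDr !reD -!/(rdot _ _) (rdotC y x).
by ring.
Qed.

Lemma nrmB2 x y : nrm (x - y) ^+ 2 = nrm x ^+ 2 - 2 * rdot x y + nrm y ^+ 2.
Proof. by rewrite nrmD2 nrmN /rdot hdotNr reN; ring. Qed.

Lemma hdot_eq0C x y : hdot x y = 0 -> hdot y x = 0.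
Proof. by rewrite hdotC => /(congr1 Num.conj); rewrite conjCK conjC0. Qed.

Lemma hdotxx_eq0 x : hdot x x = 0 -> x = 0.
Proof.
rewrite hdotxx => /(congr1 re) /= /eqP; rewrite sqrf_eq0 => /eqP.
exact: nrm_eq0.
Qed.

Lemma hdot_ext x y : (forall z, hdot x z = hdot y z) -> x = y.
Proof.
move=> h; apply/eqP; rewrite -subr_eq0; apply/eqP/hdotxx_eq0.
by rewrite hdotBl h subrr.
Qed.

(* Choosing the phase [c] turns a bound on the real part into one on the modulus. *)
Lemma phase (w : R[i]) : exists2 c : R[i], cabs c = 1 & c * w = (cabs w)%:C.
Proof.
have [->|w0] := eqVneq w 0.
  by exists 1; rewrite ?mulr0 ?ComplexField.Normc.normc1 ?ComplexField.Normc.normc0.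
have a0 : cabs w != 0 by apply: contra_neq w0; exact: cabs0_eq0.
have e : Num.conj w * w = (cabs w ^+ 2)%:C.
  rewrite cabs2; case: w {w0 a0} => a b; apply/eqP; rewrite eq_complex /=.
  by apply/andP; split; apply/eqP; ring.
exists ((cabs w)^-1%:C * Num.conj w).
  by rewrite ComplexField.Normc.normcM cabs_conj cabsR ger0_norm ?invr_ge0 ?cabs_ge0// mulVf.
by rewrite -mulrA e -rmorphM expr2 mulrA mulVf// mul1r.
Qed.

(** Cauchy-Schwarz for the real part: expand the squared norm of |y| x - |x| y and cancel 2 |x| |y|.
    The zero cases are split off for this division. *)
Lemma rdot_le x y : rdot x y <= nrm x * nrm y.
Proof.
have [y0|y0] := eqVneq (nrm y) 0.
  by rewrite (nrm_eq0 y0) /rdot hdot0r nrm0 mulr0.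
have {}y0 : 0 < nrm y by rewrite lt_def y0 nrm_ge0.
have [x0|x0] := eqVneq (nrm x) 0.
  by rewrite (nrm_eq0 x0) /rdot hdot0l nrm0 mul0r.
have {}x0 : 0 < nrm x by rewrite lt_def x0 nrm_ge0.
have : 0 <= nrm ((nrm y)%:C *: x - (nrm x)%:C *: y) ^+ 2 by exact: sqr_ge0.
rewrite nrmB2 !nrmZ !cabsR !ger0_norm ?nrm_ge0//.
rewrite /rdot hdotZl hdotZr conjE !reM /= -/(rdot x y).
rewrite !(oppr0, mul0r, subr0).
move=> h; have {h} : 0 <= (nrm x * nrm y) * 2 * (nrm x * nrm y - rdot x y) by lra.
rewrite pmulr_rge0 ?mulr_gt0// subr_ge0 //.
Qed.

Lemma hdot_le x y : cabs (hdot x y) <= nrm x * nrm y.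
Proof.
have [c c1 e] := phase (hdot x y).
have := rdot_le (c *: x) y.
by rewrite nrmZ c1 mul1r /rdot hdotZl e.
Qed.

End Basics.

(** * Limits of real sequences and norm convergence of vectors *)

Section Convergence.
Context {R : realType}.

Lemma squeeze0 (a b : nat -> R) : b @ \oo --> 0 ->
  (forall n, 0 <= a n <= b n) -> a @ \oo --> 0.
Proof.
move=> b0 ab; apply: (squeeze_cvgr _ (cvg_cst (0 : R)) b0).
by near=> n; exact: ab.
Unshelve. all: by end_near. Qed.

Lemma cvg0D (a b : nat -> R) : a @ \oo --> 0 -> b @ \oo --> 0 ->
  (fun n => a n + b n) @ \oo --> 0.
Proof. by move=> a0 b0; rewrite -(addr0 0); exact: cvgD. Qed.

Lemma cvg0Z (c : R) (a : nat -> R) : a @ \oo --> 0 ->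
  (fun n => c * a n) @ \oo --> 0.
Proof. by move=> a0; rewrite -(mulr0 c); apply: cvgM => //; exact: cvg_cst. Qed.

Lemma cvg0_cst (c : R) : (fun=> c) @ \oo --> 0 -> c = 0.
Proof.
by move=> h; rewrite -(cvg_lim _ h)// lim_cst.
Qed.

Lemma cvg0_eps (a : nat -> R) : (forall n, 0 <= a n) ->
  (forall e, 0 < e -> exists N, forall n, (N <= n)%N -> a n < e) <->
  a @ \oo --> 0.
Proof.
move=> a0; split=> [h|/cvgrPdist_lt h e e0].
  apply/cvgrPdist_lt => e e0; have [N hN] := h _ e0.
  by exists N => // n /= Nn; rewrite sub0r normrN ger0_norm// hN.
have [N _ hN] := h _ e0; exists N => n Nn.
by have := hN n Nn; rewrite /= sub0r normrN ger0_norm.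
Qed.

Lemma cvg0_lb (a : nat -> R) (c : R) : a @ \oo --> 0 -> (forall n, c <= a n) ->
  c <= 0.
Proof.
move=> a0 ca; rewrite -(cvg_lim _ a0)//.
apply: limr_ge; first by apply/cvg_ex; eexists; exact: a0.
by near=> n; exact: ca.
Unshelve. all: by end_near. Qed.

Context {H : hilbertType R}.
Implicit Types (u v : nat -> H) (x y l : H).

(** Phrased through real distances, so that limits are taken in [R] and not in the [R[i]]-valued
    uniformity. *)
Definition hcvg u l := (fun n => nrm (u n - l)) @ \oo --> 0.

Definition hcauchy u := forall e : R, 0 < e ->
  exists N, forall m n, (N <= m)%N -> (N <= n)%N -> nrm (u m - u n) < e.

Lemma hcvgP u l : hcvg u l <->
  forall e : R, 0 < e -> exists N, forall n, (N <= n)%N -> nrm (u n - l) < e.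
Proof.
by rewrite /hcvg -cvg0_eps // => n; exact: nrm_ge0.
Qed.

Lemma hcauchy_cvg u : hcauchy u -> exists l, hcvg u l.
Proof.
move=> cu.
have : cauchy (u @ \oo).
  (* A strict inequality in [R[i]] includes equality of imaginary parts, so a positive radius is
     real and only its real part matters. *)
  apply: cauchy_exP => e; rewrite ltcE /= => /andP[/eqP ie e0].
  have [N hN] := cu _ e0.
  exists (u N); exists N => // n /= Nn.
  rewrite -ball_normE /= normE ltcE /= ie eqxx /=.
  exact: hN.
move=> /cauchy_cvg /cvg_ex [l ul].
exists l; apply/hcvgP => e e0.
have e0' : 0 < e%:C by rewrite ltcR.
move/cvgrPdist_lt: ul => /(_ _ e0') [N _ hN].
exists N => n Nn; have := hN n Nn.
by rewrite /= normE ltcR nrmC.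
Qed.

Lemma hcvg_unique u l l' : hcvg u l -> hcvg u l' -> l = l'.
Proof.
move=> ul ul'; apply/eqP; rewrite -subr_eq0; apply/eqP/nrm_eq0.
have c := cvg0D ul ul'.
have : (fun=> nrm (l - l')) @ \oo --> (0 : R).
  apply: squeeze0 c _ => n; rewrite nrm_ge0 /=.
  have -> : l - l' = (u n - l') - (u n - l) by rewrite opprB [RHS]addrC addrA subrK.
  by rewrite (le_trans (nrmB _ _))// addrC.
exact: cvg0_cst.
Qed.

Lemma hcvg_cst x : hcvg (fun=> x) x.
Proof. by rewrite /hcvg subrr nrm0; exact: cvg_cst. Qed.

Lemma hcvgD u v x y : hcvg u x -> hcvg v y -> hcvg (fun n => u n + v n) (x + y).
Proof.
move=> ux vy; apply: squeeze0 (cvg0D ux vy) _ => n.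
by rewrite nrm_ge0 opprD addrACA nrmD.
Qed.

Lemma hcvgZ u x c : hcvg u x -> hcvg (fun n => c *: u n) (c *: x).
Proof.
move=> ux; apply: squeeze0 (cvg0Z (cabs c) ux) _ => n.
by rewrite nrm_ge0 /= -scalerBr nrmZ.
Qed.

Lemma hcvgB u v x y : hcvg u x -> hcvg v y -> hcvg (fun n => u n - v n) (x - y).
Proof.
move=> ux vy; rewrite -scaleN1r; have := hcvgD ux (hcvgZ (-1) vy).
by under eq_fun do rewrite scaleN1r.
Qed.

Lemma hcvg_nrm u x : hcvg u x -> (fun n => nrm (u n)) @ \oo --> nrm x.
Proof.
move=> ux; apply/cvgrPdist_le => e e0.
have [N hN] := (hcvgP u x).1 ux _ e0; exists N => // n /= Nn.
apply: le_trans (ltW (hN _ Nn)).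
rewrite ler_norml -nrmC; apply/andP; split.
  by rewrite lerNl opprB lerBlDr nrmC -{1}(subrK x (u n)) nrmD.
by rewrite lerBlDr -{1}(subrK (u n) x) nrmD.
Qed.

Lemma hcvg_nrm_le u x M : (forall n, nrm (u n) <= M) -> hcvg u x -> nrm x <= M.
Proof.
move=> uM /hcvg_nrm ux; rewrite -(cvg_lim _ ux)//.
apply: limr_le; first by apply/cvg_ex; eexists; exact: ux.
by near=> n; exact: uM.
Unshelve. all: by end_near. Qed.

Lemma hcvg_dot u x (c : nat -> R[i]) (d : R[i]) y : hcvg u x ->
  (fun n => cabs (c n - d)) @ \oo --> (0 : R) ->
  (forall n, hdot (u n) y = c n) -> hdot x y = d.
Proof.
move=> ux cd uc; apply/eqP; rewrite -subr_eq0; apply/eqP/cabs0_eq0.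
have hc := cvg0D (cvg0Z (nrm y) ux) cd.
have : (fun=> cabs (hdot x y - d)) @ \oo --> (0 : R).
  apply: squeeze0 hc _ => n; rewrite cabs_ge0 /=.
  have -> : hdot x y - d = - hdot (u n - x) y + (c n - d).
    by rewrite hdotBl uc; ring.
  rewrite (le_trans (cabsD _ _))// lerD2r normcN (le_trans (hdot_le _ _))//.
  by rewrite mulrC.
exact: cvg0_cst.
Qed.

Lemma hcvg_dot_cst u x (d : R[i]) y : hcvg u x ->
  (forall n, hdot (u n) y = d) -> hdot x y = d.
Proof.
move=> ux; apply: hcvg_dot ux _; rewrite subrr ComplexField.Normc.normc0.
exact: cvg_cst.
Qed.

End Convergence.

(** * Bounded operators *)

Section Riesz.
Context {R : realType} {H : hilbertType R}.
Variable G : H -> R[i] -> Prop.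
Hypothesis G0 : G 0 0.
Hypothesis GP : forall c x y a b, G x a -> G y b -> G (c *: x + y) (c * a + b).
Variable M : R.
Hypothesis GM : forall x a, G x a -> cabs a <= M * nrm x.

(** If a = (x | u), this equals |x - u|^2 - |u|^2, so minimising it over the graph approaches the
    representing vector u. *)
Let J (x : H) (a : R[i]) : R := nrm x ^+ 2 - 2 * re a.
Let JS := [set t | exists x a, G x a /\ t = J x a].

Let J_has_inf : has_inf JS.
Proof.
split; first by exists (J 0 0), 0, 0.
exists (- M ^+ 2) => _ [x [a [Gxa ->]]].
have := le_trans (re_le_cabs a) (GM Gxa).
have := sqr_ge0 (nrm x - M); rewrite /J; nra.
Qed.

Let m := inf JS.

Let J_ge x a : G x a -> m <= J x a.
Proof. by move=> Gxa; apply: ge_inf; [exact: J_has_inf.2|exists x, a]. Qed.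

(** The midpoint of two graph points is a graph point, hence has value at least [m]; the
    parallelogram identity then shows that minimising sequences are Cauchy. *)
Let parallelogram (x y : H) a b : G x a -> G y b ->
  nrm (x - y) ^+ 2 <= 2 * (J x a - m) + 2 * (J y b - m).
Proof.
move=> Gx Gy.
have G2 : G (2^-1%:C *: (x + y)) (2^-1%:C * (a + b)).
  have h := GP (2^-1%:C) (GP 1 Gx Gy) G0.
  by rewrite !addr0 scale1r mul1r in h.
have := J_ge G2; rewrite /J nrmZ cabsR ger0_norm ?invr_ge0 ?ler0n// exprMn.
by rewrite nrmB2 nrmD2 reM reD /=; nra.
Qed.

(* A functional on a subspace that need not be closed is given by its graph [G].
   The representing vector is the limit of a minimising sequence of
   |x|^2 - 2 Re a over the graph. *)
Lemma riesz_graph : exists u : H, (forall x a, G x a -> hdot x u = a) /\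
  forall e : R, 0 < e -> exists x a, G x a /\ nrm (x - u) < e.
Proof.
have /choice [f hf] (n : nat) :
    exists p : H * R[i], G p.1 p.2 /\ J p.1 p.2 < m + harmonic n.
  have [] := @inf_adherent _ JS (harmonic n) _ J_has_inf.
    by rewrite invr_gt0.
  by move=> _ [x [a [Gxa ->]]] h; exists (x, a).
pose x n := (f n).1; pose a n := (f n).2.
have Gx n : G (x n) (a n) by exact: (hf n).1.
have Jx n : J (x n) (a n) < m + harmonic n by exact: (hf n).2.
have xc : hcauchy x.
  move=> e e0.
  have [N hN] : exists N, forall n, (N <= n)%N -> harmonic n < e ^+ 2 / 4 :> R.
    apply: (cvg0_eps _).2 (cvg_harmonic) _ _; first by move=> n; rewrite invr_ge0.
    by rewrite divr_gt0 ?exprn_gt0.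
  exists N => i j Ni Nj.
  rewrite -(@ltr_pXn2r _ 2)// ?nnegrE ?nrm_ge0 ?(ltW e0)//.
  have := parallelogram (Gx i) (Gx j).
  have := Jx i; have := Jx j; have := hN _ Ni; have := hN _ Nj; lra.
have [u xu] := hcauchy_cvg xc.
exists u; split; last first.
  move=> e /((hcvgP x u).1 xu) [N hN]; exists (x N), (a N); split => //.
  exact: hN.
move=> y b Gy; apply/eqP; rewrite -subr_eq0; apply/eqP; set w := _ - _.
(* Moving from x_n in the direction c y cannot bring the functional below [m]; letting n tend to
   infinity leaves an inequality quadratic in c. *)
have key (c : R[i]) : 0 <= 2 * re (c * w) + cabs c ^+ 2 * nrm y ^+ 2.
  rewrite -subr_le0 sub0r.
  apply: (cvg0_lb (cvg0D (cvg0Z (2 * nrm (c *: y)) xu) cvg_harmonic)) => n.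
  have := J_ge (GP c Gy (Gx n)); have := Jx n.
  rewrite /J nrmD2 reD nrmZ exprMn.
  have := rdot_le (c *: y) (x n - u).
  rewrite /rdot hdotBr reD reN nrmZ /=; rewrite /w mulrBr reD reN -hdotZl /=.
  move: (n.+1%:R^-1) (re (hdot _ (x n))) (re (hdot _ u)) (re (c * b)) (re (a n)).
  move=> r0 r1 r2 r3 r4.
  by move=> h1 h2 h3; clear -h1 h2 h3; lra.
apply: cabs0_eq0.
have [c c1 cw] := phase w.
(* A small multiple of the rotated -|w| makes the linear term win unless w = 0; the summand 1 keeps
   the denominator positive when y = 0. *)
have := key (- (cabs w / (nrm y ^+ 2 + 1))%:C * c).
rewrite -mulrA cw -rmorphN -rmorphM /= ComplexField.Normc.normcM c1 mulr1 cabsR.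
rewrite real_normK ?num_real//.
set q := nrm y ^+ 2.
have q0 : 0 <= q by rewrite sqr_ge0.
rewrite sqrrN expr_div_n.
have -> : 2 * (- (cabs w / (q + 1)) * cabs w) + cabs w ^+ 2 / (q + 1) ^+ 2 * q =
  - ((cabs w / (q + 1)) ^+ 2 * (q + 2)) by field; lra.
rewrite oppr_ge0 pmulr_lle0; last by lra.
have := sqr_ge0 (cabs w / (q + 1)) => h1 h2.
have /eqP : (cabs w / (q + 1)) ^+ 2 = 0 by apply/eqP; rewrite eq_le h1 h2.
rewrite sqrf_eq0 mulf_eq0 invr_eq0 => /orP[/eqP//|/eqP]; lra.
Qed.

End Riesz.

Lemma le_eps_scaled {R : realType} (a b c : R) : 0 <= c ->
  (forall e, 0 < e -> a <= b + e * c) -> a <= b.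
Proof.
move=> c0 h; apply/ler_addgt0Pr => e e0.
have c1 : 0 < c + 1 by rewrite ltr_wpDl.
apply: le_trans (h (e / (c + 1)) _) _; first by rewrite divr_gt0.
by rewrite lerD2l mulrAC ler_pdivrMr// ler_pM2l// lerDl.
Qed.

Section Functional.
Context {R : realType} {H : hilbertType R}.

(** The representing vector is a limit of points in the domain of the graph. Testing it against
    these points gives the norm bound and shows that it is orthogonal to whatever that domain is
    orthogonal to. *)
Lemma riesz_rep (G : H -> R[i] -> Prop) (M : R) :
  G 0 0 -> (forall c x y a b, G x a -> G y b -> G (c *: x + y) (c * a + b)) ->
  (forall x a, G x a -> cabs a <= M * nrm x) -> 0 <= M ->
  exists u : H, [/\ forall x a, G x a -> hdot x u = a, nrm u <= M,
   forall z, (forall x a, G x a -> hdot z x = 0) -> hdot z u = 0 &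
   forall e : R, 0 < e -> exists x a, G x a /\ nrm (x - u) < e].
Proof.
move=> G0 GP GM M0; have [u [Gu uc]] := riesz_graph G0 GP GM.
exists u; split=> //.
- have [u0|u0] := eqVneq (nrm u) 0; first by rewrite u0.
  have {}u0 : 0 < nrm u by rewrite lt_def u0 nrm_ge0.
  rewrite -(ler_pM2r u0) -expr2.
  apply: (@le_eps_scaled _ _ _ (M + nrm u)); first by rewrite addr_ge0 ?nrm_ge0.
  move=> e /uc [x [a [Gxa xe]]].
  have h1 := le_trans (re_le_cabs _) (GM _ _ Gxa).
  have h2 : rdot x u = re a by rewrite /rdot (Gu _ _ Gxa).
  have h3 : nrm u ^+ 2 = rdot x u - rdot (x - u) u.
    by rewrite -rdotxx /rdot hdotBl reD reN; ring.
  have h4 := rdot_le (- (x - u)) u.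
  have h5 : nrm x <= e + nrm u.
    by rewrite -(subrK u x) (le_trans (nrmD _ _))// lerD2r ltW.
  have h6 : nrm (x - u) * nrm u <= e * nrm u by rewrite ler_wpM2r// ltW.
  have h7 : M * nrm x <= M * (e + nrm u) by rewrite ler_wpM2l.
  rewrite {1}/rdot hdotNl reN nrmN in h4.
  rewrite h3 h2; rewrite -/(rdot _ _) in h4.
  by move: (re a) (rdot (x - u) u) h1 h4 => r1 r2; lra.
- move=> z hz; apply: cabs0_eq0; apply/eqP; rewrite eq_le cabs_ge0 andbT.
  apply: (@le_eps_scaled _ _ _ (nrm z)); first exact: nrm_ge0.
  move=> e /uc [x [a [Gxa xe]]]; rewrite add0r.
  have -> : hdot z u = - hdot z (x - u) by rewrite hdotBr (hz _ _ Gxa) sub0r opprK.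
  rewrite normcN (le_trans (hdot_le _ _))// mulrC ler_wpM2r// ?nrm_ge0// ltW//.
Qed.

End Functional.

(** * Adjoints, extensions, projections and ranges *)

Section Operators.
Context {R : realType}.
Implicit Types (U V H : hilbertType R).

Definition bounded_by V H (T : V -> H) (M : R) := forall x, nrm (T x) <= M * nrm x.

Definition adjoint V H (T : V -> H) (S : H -> V) :=
  forall x y, hdot (T x) y = hdot x (S y).

Lemma adjC V H (T : V -> H) (S : H -> V) : adjoint T S -> adjoint S T.
Proof. by move=> h x y; rewrite hdotC -h -hdotC. Qed.

Lemma bounded_operatorP V H (T : {linear V -> H}) :
  bounded_operator T <-> exists2 M : R, 0 <= M & bounded_by T M.
Proof.
split=> [[M hM]|[M M0 hM]].
  exists `|re M|; first exact: normr_ge0.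
  move=> x; have := hM x.
  rewrite !normE lecE /= => /andP[_ h].
  apply: (le_trans h); rewrite reM /= mulr0 subr0.
  by rewrite ler_wpM2r ?nrm_ge0// ler_norm.
by exists M%:C => x; rewrite !normE -rmorphM lecR.
Qed.

Lemma ex_linear V H (f : V -> H) :
  (forall c x y, f (c *: x + y) = c *: f x + f y) ->
  exists T : {linear V -> H}, forall x, T x = f x.
Proof.
move=> hf.
by exists (HB.pack f (GRing.isLinear.Build _ _ _ _ f hf) : {linear V -> H}).
Qed.

(** [S] is the adjoint of the partially defined operator with graph [G]: [S y] represents a |-> (b |
    y). Linearity follows because a representing vector in the closure of the domain is unique. *)
Lemma graph_dual V H (G : V -> H -> Prop) (M : R) :
  G 0 0 ->
  (forall c x y a b, G x a -> G y b -> G (c *: x + y) (c *: a + b)) ->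
  (forall x a, G x a -> nrm a <= M * nrm x) -> 0 <= M ->
  exists S : {linear H -> V}, [/\ bounded_by S M,
    forall a b y, G a b -> hdot a (S y) = hdot b y,
    forall x y, (forall a b, G a b -> hdot x a = 0) -> hdot x (S y) = 0 &
    forall y (e : R), 0 < e -> exists a b, G a b /\ nrm (a - S y) < e].
Proof.
move=> G0 GP GM M0.
have /choice [f hf] (y : H) : exists u : V,
    [/\ forall a b, G a b -> hdot a u = hdot b y, nrm u <= M * nrm y,
     forall x, (forall a b, G a b -> hdot x a = 0) -> hdot x u = 0 &
     forall e : R, 0 < e -> exists a b, G a b /\ nrm (a - u) < e].
  have [||||u [h1 h2 h3 h4]] :=
    @riesz_rep _ _ (fun x c => exists2 b, G x b & c = hdot b y) (M * nrm y).
  - by exists 0 => //; rewrite hdot0l.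
  - move=> c x x' _ _ [b Gb ->] [b' Gb' ->]; exists (c *: b + b').
      exact: GP.
    by rewrite hdotDl hdotZl.
  - move=> x _ [b Gb ->]; rewrite (le_trans (hdot_le _ _))//.
    by rewrite mulrAC ler_wpM2r ?nrm_ge0// GM.
  - by rewrite mulr_ge0// nrm_ge0.
  exists u; split=> // [a b Gb|x hx|e /h4[a [_ [[b Gb _] h]]]].
  - by apply: h1; exists b.
  - by apply: h3 => z a [b Gb _]; exact: hx Gb.
  - by exists a, b.
have flin c x y : f (c *: x + y) = c *: f x + f y.
  apply/eqP; rewrite -subr_eq0; apply/eqP/hdotxx_eq0; set d := _ - _.
  (* The defect [d] of additivity and homogeneity is orthogonal to the domain of the graph; since it
     also lies in the closure of that domain, it is orthogonal to itself. *)
  have dG a b : G a b -> hdot d a = 0.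
    move=> Gb; apply: hdot_eq0C; rewrite /d hdotBr hdotDr hdotZr.
    have [h1 _ _ _] := hf (c *: x + y); have [h2 _ _ _] := hf x.
    have [h3 _ _ _] := hf y; rewrite (h1 _ _ Gb) (h2 _ _ Gb) (h3 _ _ Gb).
    by rewrite hdotDr hdotZr subrr.
  rewrite {2}/d hdotBr hdotDr hdotZr.
  have [_ _ h1 _] := hf (c *: x + y); have [_ _ h2 _] := hf x.
  by have [_ _ h3 _] := hf y; rewrite h1// h2// h3// mulr0 addr0 subrr.
have [S hS] := ex_linear flin.
exists S; split=> [x|a b y|x y|y]; rewrite hS.
- by have [_ h _ _] := hf x.
- by move=> Gab; have [h _ _ _] := hf y; rewrite (h _ _ Gab).
- by move=> hx; have [_ _ h _] := hf y; exact: h.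
- by have [_ _ _ h] := hf y.
Qed.

Lemma adjoint_ex V H (T : {linear V -> H}) (M : R) : 0 <= M -> bounded_by T M ->
  exists S : {linear H -> V}, adjoint T S /\ bounded_by S M.
Proof.
move=> M0 TM; have [||||S [h1 h2 _ _]] := @graph_dual V H (fun x y => y = T x) M.
- by rewrite linear0.
- by move=> c x y _ _ -> ->; rewrite linearP.
- by move=> x _ ->.
- by [].
by exists S; split=> // x y; rewrite (h2 x (T x)).
Qed.

(** Dualising twice extends the operator with graph [G] to the whole space; by the last clause the
    extension vanishes on the orthogonal complement of the original domain. *)
Lemma extend_graph V H (G : V -> H -> Prop) (M : R) :
  G 0 0 ->
  (forall c x y a b, G x a -> G y b -> G (c *: x + y) (c *: a + b)) ->
  (forall x a, G x a -> nrm a <= M * nrm x) -> 0 <= M ->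
  exists (T : {linear V -> H}) (S : {linear H -> V}), [/\ bounded_by T M, adjoint T S,
    forall a b, G a b -> T a = b,
    forall a b y, G a b -> hdot a (S y) = hdot b y &
    forall x y, (forall a b, G a b -> hdot x a = 0) -> hdot x (S y) = 0].
Proof.
move=> G0 GP GM M0; have [S [h1 h2 h3 _]] := graph_dual G0 GP GM M0.
have [T [TS TM]] := adjoint_ex M0 h1; exists T, S; split=> //.
- exact: adjC.
- by move=> a b Gab; apply: hdot_ext => y; rewrite (adjC TS) (h2 _ _ _ Gab).
Qed.

(** The dual of the identity restricted to a closed subspace is the orthogonal projection onto that
    subspace. *)
Lemma orth_proj H (W : set H) :
  exists P : {linear H -> H}, [/\ bounded_by P 1,
    forall x, orthogonal_complement W (P x) &
    forall x y, orthogonal_complement W y -> hdot x y = hdot (P x) y].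
Proof.
have [||||P [h1 h2 h3 _]] := @graph_dual H H
  (fun x y => orthogonal_complement W x /\ y = x) 1.
- by split=> // x _; rewrite hdot0l.
- move=> c x y _ _ [Wx ->] [Wy ->]; split=> // z Wz.
  by rewrite hdotDl hdotZl Wx// Wy// mulr0 addr0.
- by move=> x _ [_ ->]; rewrite mul1r.
- exact: ler01.
exists P; split=> // [x y Wy|x y Wy].
- by apply: hdot_eq0C; apply: h3 => a _ [Wa _]; apply: hdot_eq0C; exact: Wa.
- by rewrite hdotC [RHS]hdotC (h2 y y x).
Qed.

(** A range criterion of Douglas type: the bound makes S g |-> (g | f) a bounded functional on the
    range of [S], and a vector representing it is a preimage of [f]. *)
Lemma range_adjoint V H (T : {linear V -> H}) (S : {linear H -> V}) f (c : R) :
  0 <= c -> adjoint T S -> (forall g, cabs (hdot f g) <= c * nrm (S g)) ->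
  exists u, T u = f.
Proof.
move=> c0 TS hc; have [||||u [h1 _ _ _]] :=
  @riesz_rep _ _ (fun x a => exists2 g, x = S g & a = hdot g f) c.
- by exists 0; rewrite ?linear0 ?hdot0l.
- move=> k _ _ _ _ [g -> ->] [g' -> ->]; exists (k *: g + g').
    by rewrite linearP.
  by rewrite hdotDl hdotZl.
- by move=> _ _ [g -> ->]; rewrite hdotC cabs_conj.
- by [].
exists u; apply: hdot_ext => g; rewrite hdotC [RHS]hdotC; congr Num.conj.
by rewrite -(adjC TS) (h1 _ (hdot g f)) //; exists g.
Qed.

(** Representing (. | x) on the range produces a point u of its closure with x - u orthogonal to the
    range, so x = u. *)
Lemma dense_range V H (T : {linear V -> H}) :
  (forall f, (forall u, hdot f (T u) = 0) -> f = 0) -> dense (range T).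
Proof.
move=> h O [x Ox] oO.
have [||||u [h1 _ _ h2]] :=
  @riesz_rep _ _ (fun y a => exists2 u, y = T u & a = hdot y x) (nrm x).
- by exists 0; rewrite ?linear0 ?hdot0l.
- move=> k _ _ _ _ [g -> ->] [g' -> ->]; exists (k *: g + g').
    by rewrite linearP.
  by rewrite hdotDl hdotZl.
- by move=> _ _ [g -> ->]; rewrite mulrC hdot_le.
- exact: nrm_ge0.
have ux : x = u.
  apply/eqP; rewrite -subr_eq0; apply/eqP/h => v; apply: hdot_eq0C.
  by rewrite hdotBr (h1 (T v) (hdot (T v) x)) ?subrr//; exists v.
have /nbhs_ballP [e /= e0 he] : nbhs x O by exact: open_nbhs_nbhs.
move: e0; rewrite ltcE /= => /andP[/eqP ie e0].
have [y [a [[v yv _] ye]]] := h2 _ e0.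
exists y; split; last by exists v.
apply: he; rewrite -ball_normE /= normE ltcE /= ie eqxx /=.
by rewrite nrmC ux.
Qed.

Lemma dense_orth H (D : set H) f : dense D -> (forall y, D y -> hdot f y = 0) ->
  f = 0.
Proof.
move=> dD h; apply: nrm_eq0; apply/eqP; rewrite eq_le nrm_ge0 andbT.
rewrite leNgt; apply/negP => f0.
have [||y [fy Dy]] := dD (ball f (nrm f)%:C).
- by exists f; apply: ballxx; rewrite ltcR.
- exact: ball_open.
move: fy; rewrite -ball_normE /= normE ltcR => fy.
have : nrm f ^+ 2 <= nrm f * nrm (f - y).
  apply: le_trans (rdot_le _ _).
  by rewrite -rdotxx /rdot hdotBr (h _ Dy) subr0.
by rewrite expr2 ler_pM2l// leNgt fy.
Qed.

End Operators.

Section RealDot.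
Context {R : realType} {H : hilbertType R}.
Implicit Types (x y z : H) (t : R).

Lemma rdotBl x y z : rdot (x - y) z = rdot x z - rdot y z.
Proof. by rewrite /rdot hdotBl reD reN. Qed.
Lemma rdotBr x y z : rdot z (x - y) = rdot z x - rdot z y.
Proof. by rewrite /rdot hdotBr reD reN. Qed.
Lemma rdotZl t x y : rdot (t%:C *: x) y = t * rdot x y.
Proof. by rewrite /rdot hdotZl reM /= mul0r subr0. Qed.
Lemma rdotZr t x y : rdot x (t%:C *: y) = t * rdot x y.
Proof. by rewrite rdotC rdotZl rdotC. Qed.

End RealDot.

Lemma hcvg_shift {R : realType} {H : hilbertType R} (u : nat -> H) l :
  hcvg u l -> hcvg (fun n => u n.+1) l.
Proof.
move=> /hcvgP h; apply/hcvgP => e /h [N hN]; exists N => n Nn.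
by apply: hN; exact: leqW.
Qed.

Lemma hcvg_dist_le {R : realType} {H : hilbertType R} (u : nat -> H) l
    (b : nat -> R) :
  b @ \oo --> 0 -> (forall n, nrm (u n - l) <= b n) -> hcvg u l.
Proof. by move=> b0 h; apply: squeeze0 b0 _ => n; rewrite nrm_ge0 h. Qed.

Lemma hcvg_dotr {R : realType} {H : hilbertType R} (u v : nat -> H) a b (x y : H) :
  hcvg u a -> hcvg v b -> (forall n, hdot (u n) y = hdot x (v n)) ->
  hdot a y = hdot x b.
Proof.
move=> ua vb uv; apply: (hcvg_dot ua _ uv).
apply: squeeze0 (cvg0Z (nrm x) vb) _ => n; rewrite cabs_ge0 -hdotBr.
exact: hdot_le.
Qed.

(** * Square roots of positive operators *)

Section SquareRoot.
Context {R : realType} {H : hilbertType R}.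
Variable X : {linear H -> H}.
Hypothesis X1 : bounded_by X 1.
Hypothesis Xadj : adjoint X X.

(* [1 - sqrt (1 - X)] is the strong limit of [Y_(n+1) = (X + Y_n^2) / 2]. The same
   recursion for [X = 1] gives scalars whose increments dominate those of [Y_n]. *)
Fixpoint sqrt_seq n (x : H) : H :=
  if n is k.+1 then 2^-1%:C *: (X x + sqrt_seq k (sqrt_seq k x)) else 0.

Fixpoint scalar_sqrt_seq n : R := if n is k.+1 then (1 + scalar_sqrt_seq k ^+ 2) / 2 else 0.

Lemma sqrt_seq_linear n c x y : sqrt_seq n (c *: x + y) = c *: sqrt_seq n x + sqrt_seq n y.
Proof.
elim: n x y => [|n IH] x y /=; first by rewrite scaler0 addr0.
by rewrite !IH linearP addrACA -(scalerDr c) (scalerDr 2^-1%:C) !scalerA (mulrC c).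
Qed.

Lemma sqrt_seqS n x : sqrt_seq n.+1 x = 2^-1%:C *: (X x + sqrt_seq n (sqrt_seq n x)).
Proof. by []. Qed.

Lemma sqrt_seq_adj n : adjoint (sqrt_seq n) (sqrt_seq n).
Proof.
elim: n => [|n IH] x y /=; first by rewrite hdot0l hdot0r.
by rewrite hdotZl hdotZr hdotDl hdotDr Xadj !IH conjE /= oppr0.
Qed.

(** Linearity of [Z] is assumed in unbundled form so that [Z] can be another iterate, which is how
    the iterates are shown to commute. *)
Lemma sqrt_seq_comm (Z : H -> H) : (forall c x y, Z (c *: x + y) = c *: Z x + Z y) ->
  (forall x, Z (X x) = X (Z x)) -> forall n x, Z (sqrt_seq n x) = sqrt_seq n (Z x).
Proof.
move=> Zl ZX.
have Z0 : Z 0 = 0.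
  by have := Zl 1 0 0; rewrite !scale1r addr0 => /eqP; rewrite -subr_eq subrr => /eqP.
have ZZ c x : Z (c *: x) = c *: Z x by rewrite -[c *: x]addr0 Zl Z0 addr0.
have ZD x y : Z (x + y) = Z x + Z y by rewrite -[x]scale1r Zl !scale1r.
by elim=> [//|n IH] x /=; rewrite ZZ ZD ZX !IH.
Qed.

Lemma sqrt_seqC m n x : sqrt_seq m (sqrt_seq n x) = sqrt_seq n (sqrt_seq m x).
Proof.
apply: sqrt_seq_comm; first exact: sqrt_seq_linear.
by move=> y; rewrite -(sqrt_seq_comm (Z := X))// => c a b; exact: linearP.
Qed.

Lemma scalar_sqrt_seq_ge0 n : 0 <= scalar_sqrt_seq n.
Proof. by case: n => //= n; rewrite divr_ge0// addr_ge0// sqr_ge0. Qed.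

Lemma scalar_sqrt_seq_le1 n : scalar_sqrt_seq n <= 1.
Proof.
elim: n => //= n IH; rewrite ler_pdivrMr// mul1r.
by have := scalar_sqrt_seq_ge0 n; nra.
Qed.

Lemma scalar_sqrt_seq_leS n : scalar_sqrt_seq n <= scalar_sqrt_seq n.+1.
Proof. by rewrite /= ler_pdivlMr//; have := sqr_ge0 (scalar_sqrt_seq n - 1); nra. Qed.

Lemma sqrt_seqB n x y : sqrt_seq n (x - y) = sqrt_seq n x - sqrt_seq n y.
Proof. by rewrite addrC -scaleN1r sqrt_seq_linear scaleN1r addrC. Qed.

Lemma sqrt_seqD n x y : sqrt_seq n (x + y) = sqrt_seq n x + sqrt_seq n y.
Proof. by rewrite -{1}[x]scale1r sqrt_seq_linear scale1r. Qed.

Lemma sqrt_seq_bd n : bounded_by (sqrt_seq n) (scalar_sqrt_seq n).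
Proof.
elim: n => [|n IH] x /=; first by rewrite nrm0 mul0r.
rewrite nrmZ cabsR ger0_norm ?invr_ge0// mulrC (mulrAC _ 2^-1) ler_wpM2r ?invr_ge0//.
rewrite (le_trans (nrmD _ _))// mulrDl lerD//.
by rewrite (le_trans (IH _))// expr2 -mulrA ler_wpM2l// scalar_sqrt_seq_ge0.
Qed.

(** As the iterates commute, Y_(n+2) - Y_(n+1) = (Y_(n+1) - Y_n) (Y_(n+1) + Y_n) / 2. The scalar
    sequence satisfies the same identity, so the bound passes from n to n + 1. *)
Lemma sqrt_seq_step n x :
  nrm (sqrt_seq n.+1 x - sqrt_seq n x) <= (scalar_sqrt_seq n.+1 - scalar_sqrt_seq n) * nrm x.
Proof.
elim: n x => [|n IH] x.
  have := sqrt_seq_bd 1 x; by rewrite /= !subr0.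
have -> : sqrt_seq n.+2 x - sqrt_seq n.+1 x =
    2^-1%:C *: (sqrt_seq n.+1 (sqrt_seq n.+1 x + sqrt_seq n x) -
                sqrt_seq n (sqrt_seq n.+1 x + sqrt_seq n x)).
  rewrite (sqrt_seqS n.+1 x) {2}(sqrt_seqS n x) -scalerBr.
  congr (_ *: _); rewrite !sqrt_seqD (sqrt_seqC n n.+1) [in RHS]opprD [in RHS]addrA addrK.
  by rewrite opprD addrACA subrr add0r.
rewrite nrmZ cabsR ger0_norm ?invr_ge0//.
have -> : (scalar_sqrt_seq n.+2 - scalar_sqrt_seq n.+1) * nrm x =
    2^-1 * ((scalar_sqrt_seq n.+1 - scalar_sqrt_seq n) *
            ((scalar_sqrt_seq n.+1 + scalar_sqrt_seq n) * nrm x)).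
  rewrite [scalar_sqrt_seq n.+2]/= -/(scalar_sqrt_seq n.+1) [X in (_ - X) * _ = _]/=.
  by move: (scalar_sqrt_seq n.+1) (scalar_sqrt_seq n) (nrm x) => a b c; field.
rewrite ler_wpM2l ?invr_ge0// (le_trans (IH _))// ler_wpM2l//.
  by rewrite subr_ge0 scalar_sqrt_seq_leS.
by rewrite (le_trans (nrmD _ _))// mulrDl lerD// sqrt_seq_bd.
Qed.

Lemma sqrt_seq_dist m n x : (n <= m)%N ->
  nrm (sqrt_seq m x - sqrt_seq n x) <= (scalar_sqrt_seq m - scalar_sqrt_seq n) * nrm x.
Proof.
move=> /subnK <-; elim: (m - n)%N => [|k IH].
  by rewrite add0n !subrr nrm0 mul0r.
have -> : sqrt_seq (k.+1 + n) x - sqrt_seq n x =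
  (sqrt_seq (k + n).+1 x - sqrt_seq (k + n) x) + (sqrt_seq (k + n) x - sqrt_seq n x).
  by rewrite addrA subrK.
rewrite (le_trans (nrmD _ _))//.
rewrite addSn (le_trans (lerD (sqrt_seq_step _ _) IH))//.
by rewrite -mulrDl addrA subrK.
Qed.

Lemma scalar_sqrt_seq_cvg : exists2 l, forall n, scalar_sqrt_seq n <= l &
  (fun n => l - scalar_sqrt_seq n) @ \oo --> 0.
Proof.
have nd : nondecreasing_seq scalar_sqrt_seq.
  by apply/nondecreasing_seqP; exact: scalar_sqrt_seq_leS.
have cv : cvgn scalar_sqrt_seq.
  apply: nondecreasing_is_cvgn => //.
  by exists 1 => _ [n _ <-]; exact: scalar_sqrt_seq_le1.
exists (limn scalar_sqrt_seq); first by move=> n; exact: nondecreasing_cvgn_le.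
rewrite -(subrr (limn scalar_sqrt_seq)); apply: cvgB => //; exact: cvg_cst.
Qed.

(** The limit equation 2 Y = X + Y^2 says that (1 - Y)^2 = 1 - X. *)
Lemma half_sqrt_ex : exists Y : {linear H -> H},
  [/\ bounded_by Y 1, adjoint Y Y & forall x, 2%:R%:C *: Y x = X x + Y (Y x)].
Proof.
have [l yl l0] := scalar_sqrt_seq_cvg.
have dist m n x : (n <= m)%N ->
    nrm (sqrt_seq m x - sqrt_seq n x) <= (l - scalar_sqrt_seq n) * nrm x.
  move=> nm; rewrite (le_trans (sqrt_seq_dist _ nm))// ler_wpM2r ?nrm_ge0//.
  by rewrite lerD2r.
have /choice [f fx] (x : H) : exists y, hcvg (sqrt_seq^~ x) y.
  apply: hcauchy_cvg => e e0.
  have l0x := cvg0Z (nrm x) l0.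
  have p n : 0 <= nrm x * (l - scalar_sqrt_seq n) by rewrite mulr_ge0 ?nrm_ge0// subr_ge0.
  have [|N hN] := (cvg0_eps p).2 l0x (e / 2); first by rewrite divr_gt0.
  exists N => m n Nm Nn; rewrite (le_lt_trans (nrm_dist (sqrt_seq N x) _ _))//.
  rewrite (splitr e) ltrD// (le_lt_trans (dist _ _ _ _))// mulrC; exact: hN.
have flin c x y : f (c *: x + y) = c *: f x + f y.
  apply: hcvg_unique (fx _) _; under eq_fun do rewrite sqrt_seq_linear.
  by apply: hcvgD => //; exact: hcvgZ.
have [Y Yf] := ex_linear flin.
have Ybd : bounded_by Y 1.
  move=> x; rewrite Yf; apply: hcvg_nrm_le (fx x) => n.
  by rewrite (le_trans (sqrt_seq_bd _ _))// ler_wpM2r ?nrm_ge0// scalar_sqrt_seq_le1.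
exists Y; split=> // [x y|x].
  by rewrite !Yf; apply: hcvg_dotr (fx x) (fx y) _ => n; exact: sqrt_seq_adj.
have h1 : hcvg (fun n => 2%:R%:C *: sqrt_seq n.+1 x) (2%:R%:C *: Y x).
  by rewrite Yf; apply: hcvgZ; exact: (hcvg_shift (fx x)).
apply: (hcvg_unique h1).
under eq_fun do rewrite sqrt_seqS scalerA -rmorphM mulfV ?pnatr_eq0// scale1r.
apply: hcvgD; first exact: hcvg_cst.
have b0 := cvg0D (fx x) (fx (f x)).
apply: (hcvg_dist_le b0) => n; rewrite !Yf.
rewrite (le_trans (nrm_dist (sqrt_seq n (f x)) _ _))// lerD//; last by rewrite nrmC.
rewrite -sqrt_seqB (le_trans (sqrt_seq_bd _ _))// -[leRHS]mul1r.
by rewrite ler_wpM2r ?nrm_ge0// scalar_sqrt_seq_le1.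
Qed.

End SquareRoot.

(** With N = M + 1, positive even for M = 0, the operator X = 1 - T / N is a self-adjoint
    contraction, and K = sqrt N (1 - Y) satisfies K^2 = N (1 - X) = T. *)
Lemma sqrt_op {R : realType} {H : hilbertType R} (T : {linear H -> H}) (M : R) :
  0 <= M -> bounded_by T M -> adjoint T T -> (forall x, 0 <= rdot (T x) x) ->
  exists K : {linear H -> H}, [/\ exists2 M', 0 <= M' & bounded_by K M', adjoint K K &
    forall x, K (K x) = T x].
Proof.
move=> M0 TM TT T0; pose N := M + 1; pose t := N^-1.
have N0 : 0 < N by rewrite ltr_wpDl.
have t0 : 0 < t by rewrite invr_gt0.
have TN : bounded_by T N by move=> x; rewrite (le_trans (TM x))// ler_wpM2r ?nrm_ge0// lerDl.
have Xlin c x y : (c *: x + y) - t%:C *: T (c *: x + y) =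
    c *: (x - t%:C *: T x) + (y - t%:C *: T y).
  rewrite linearP scalerDr opprD addrACA scalerBr; congr (_ - _ + _).
  by rewrite !scalerA mulrC.
have [X XE] := ex_linear Xlin.
(* Positivity of [T] at the vector x - t T x, together with t |T| <= 1, yields the inequality that
   makes [X] contractive. *)
have TTN x : t * nrm (T x) ^+ 2 <= rdot (T x) x.
  have := T0 (x - t%:C *: T x); rewrite linearB linearZ /=.
  rewrite rdotBl !rdotBr !rdotZl !rdotZr.
  have -> : rdot (T (T x)) x = nrm (T x) ^+ 2 by rewrite /rdot TT -rdotxx.
  rewrite rdotxx.
  have h1 : rdot (T (T x)) (T x) <= N * nrm (T x) ^+ 2.
    by rewrite (le_trans (rdot_le _ _))// expr2 mulrA ler_wpM2r ?nrm_ge0.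
  have h2 : t * (t * rdot (T (T x)) (T x)) <= t * nrm (T x) ^+ 2.
    rewrite ler_wpM2l ?(ltW t0)//.
    have := ler_wpM2l (ltW t0) h1; rewrite mulrA mulVf ?mul1r// gt_eqF//.
  move: (rdot (T x) x) (rdot (T (T x)) (T x)) (nrm _ ^+ 2) h2 => a b c h2 h3.
  by clear -h2 h3; lra.
have X1 : bounded_by X 1.
  move=> x; rewrite mul1r -(@ler_pXn2r _ 2)// ?nnegrE ?nrm_ge0// XE.
  rewrite nrmB2 rdotZr nrmZ cabsR ger0_norm ?(ltW t0)// exprMn.
  have := ler_wpM2l (ltW t0) (TTN x); have := mulr_ge0 (ltW t0) (T0 x).
  rewrite (rdotC x) expr2.
  move: (rdot (T x) x) (nrm (T x) ^+ 2) (nrm x ^+ 2) => a b c h2 h3.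
  by clear -h2 h3; lra.
have XX : adjoint X X.
  move=> x y; rewrite !XE hdotBl hdotBr hdotZl hdotZr TT conjE /=.
  by rewrite oppr0.
have [Y [Y1 YY YE]] := half_sqrt_ex X1 XX.
pose s := Num.sqrt N.
have Klin c x y : s%:C *: ((c *: x + y) - Y (c *: x + y)) =
    c *: (s%:C *: (x - Y x)) + s%:C *: (y - Y y).
  rewrite linearP opprD addrACA -scalerBr scalerDr; congr (_ + _).
  by rewrite !scalerA mulrC.
have [K KE] := ex_linear Klin.
exists K; split.
- exists (s * 2); first by rewrite mulr_ge0// sqrtr_ge0.
  move=> x; rewrite KE nrmZ cabsR ger0_norm ?sqrtr_ge0// -mulrA.
  rewrite ler_wpM2l ?sqrtr_ge0// (le_trans (nrmB _ _))//.
  have := Y1 x; rewrite mul1r => h; rewrite mulr_natl mulr2n lerD2l//.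
- move=> x y; rewrite !KE hdotZl hdotZr hdotBl hdotBr YY conjE /=.
  by rewrite oppr0.
- move=> x; rewrite !KE linearZ /=.
  rewrite -!scalerBr (raddfB Y) scalerA -rmorphM -expr2 sqr_sqrtr ?(ltW N0)//.
  have -> : x - Y x - (Y x - Y (Y x)) = t%:C *: T x.
    have -> : t%:C *: T x = x - X x by rewrite XE opprB addrCA subrr addr0.
    have -> : X x = 2%:R%:C *: Y x - Y (Y x) by rewrite YE addrK.
    have -> : 2%:R%:C *: Y x = Y x + Y x by rewrite rmorphMn /= scaler_nat mulr2n.
    by rewrite -[in RHS]addrA [in RHS]opprD addrA.
  by rewrite scalerA -rmorphM mulfV ?gt_eqF// scale1r.
Qed.

Lemma rdot_adj {R : realType} {V H : hilbertType R} (T : V -> H) (S : H -> V) :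
  adjoint T S -> forall x y, rdot (T x) y = rdot x (S y).
Proof. by move=> TS x y; rewrite /rdot TS. Qed.

(** * The range of I + A *)

Section Forms.
Context {R : realType}.
Implicit Types (V H : hilbertType R).

Definition form_bd V (a : V -> V -> R[i]) (C : R) :=
  forall u v, cabs (a u v) <= C * nrm u * nrm v.

(** Continuity at the origin gives a radius d within which the form stays below 1; scaling both
    arguments to norm d / 2 produces the constant (2 / d)^2. *)
Lemma form_continuous_bd V (a : sesquilinear_form V) :
  continuous_form a -> exists2 C : R, 0 <= C & form_bd a C.
Proof.
move=> /(_ (0, 0)) /cvgrPdist_lt /(_ 1 ltr01) /= /nbhs_ballP [e /= e0 he].
move: e0; rewrite ltcE /= => /andP[/eqP ie e0].
set d := re e in e0.
have small u v : nrm u < d -> nrm v < d -> cabs (a u v) < 1.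
  move=> ud vd; have := he (u, v); rewrite linear0l sub0r normrN absE ltcR; apply.
  by split; rewrite -ball_normE /= sub0r normrN normE ltcE /= ie eqxx.
exists ((2 / d) ^+ 2); first exact: sqr_ge0.
move=> u v.
have [->|u0] := eqVneq u 0.
  by rewrite linear0l nrm0 mulr0 mul0r ComplexField.Normc.normc0.
have [->|v0] := eqVneq v 0.
  by rewrite linear0r nrm0 mulr0 ComplexField.Normc.normc0.
have {}u0 : 0 < nrm u.
  by rewrite lt_def nrm_ge0 andbT; apply: contra_neq u0; exact: nrm_eq0.
have {}v0 : 0 < nrm v.
  by rewrite lt_def nrm_ge0 andbT; apply: contra_neq v0; exact: nrm_eq0.
have sc (w : V) : 0 < nrm w -> nrm ((d / 2 / nrm w)%:C *: w) < d.
  move=> w0; rewrite nrmZ cabsR ger0_norm; last by rewrite !divr_ge0 ?ltW.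
  by rewrite divfK ?gt_eqF// ltr_pdivrMr// ltr_pMr// ltr1n.
have := ltW (small _ _ (sc _ u0) (sc _ v0)).
rewrite linearZl_LR linearZr_LR /= !ComplexField.Normc.normcM cabs_conj !cabsR.
rewrite !ger0_norm; [|by rewrite !divr_ge0 ?nrm_ge0 ?(ltW e0)..].
have -> : (2 / d) ^+ 2 * nrm u * nrm v = (d / 2 / nrm u * (d / 2 / nrm v))^-1.
  by field; rewrite !gt_eqF.
rewrite (mulrA _ _ (cabs _)) => h; rewrite -[leRHS]mul1r ler_pdivlMr 1?mulrC//.
by rewrite mulr_gt0// !divr_gt0.
Qed.

Lemma form_bd_continuous V (a : sesquilinear_form V) (C : R) :
  0 <= C -> form_bd a C -> continuous_form a.
Proof.
move=> C0 aC [u0 v0]; apply/cvgrPdist_lt => e /=.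
rewrite ltcE /= => /andP[/eqP ie e0]; set r := re e in e0.
(* The two parts of the difference of values add up to at most d (q - 1), while d q <= r; the bound
   d <= 1 keeps |v| below |v0| + 1. *)
pose q := C * (nrm v0 + 1 + nrm u0) + 1.
have q0 : 0 < q by rewrite ltr_wpDl// mulr_ge0// !addr_ge0 ?nrm_ge0.
pose d := Num.min 1 (r / q).
have d0 : 0 < d by rewrite lt_min ltr01 divr_gt0.
exists (ball u0 d%:C, ball v0 d%:C); first by split; apply: nbhsx_ballx; rewrite ltcR.
move=> [u v] /= [] /=; rewrite -!ball_normE /= !normE !ltcR => ud vd.
rewrite absE ltcE /= ie eqxx /=.
have -> : a u0 v0 - a u v = a (u0 - u) v + a u0 (v0 - v).
  by rewrite linearBl linearBr /=; ring.
have hv : nrm v <= nrm v0 + 1.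
  rewrite -(subrK v0 v) addrC (le_trans (nrmD _ _))// lerD2l nrmC ltW//.
  by rewrite (lt_le_trans vd)// ge_min lexx.
rewrite (le_lt_trans (cabsD _ _))// (le_lt_trans (lerD (aC _ _) (aC _ _)))//.
have h1 : C * nrm (u0 - u) * nrm v <= C * d * (nrm v0 + 1).
  by rewrite ler_pM ?mulr_ge0 ?nrm_ge0// ler_wpM2l// ltW.
have h2 : C * nrm u0 * nrm (v0 - v) <= C * nrm u0 * d.
  by rewrite ler_wpM2l ?mulr_ge0 ?nrm_ge0// ltW.
rewrite (le_lt_trans (lerD h1 h2))//.
have h3 : d <= r / q by rewrite ge_min lexx orbT.
have -> : C * d * (nrm v0 + 1) + C * nrm u0 * d = d * (q - 1).
  by rewrite /q; ring.
have : d * q <= r by rewrite -ler_pdivlMr.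
by rewrite mulrBr mulr1; move: (d * q) => dq; move: d0 => d0' h; clear -d0' h; lra.
Qed.

Lemma form_operator V (b : V -> V -> R[i]) (C : R) : 0 <= C ->
  (forall c x y z, b (c *: x + y) z = c * b x z + b y z) ->
  (forall c x y z, b z (c *: x + y) = Num.conj c * b z x + b z y) ->
  form_bd b C ->
  exists2 B : {linear V -> V}, bounded_by B C & forall u v, hdot (B u) v = b u v.
Proof.
move=> C0 bl br bC.
have b0 z : b z 0 = 0.
  by have := br 1 0 0 z; rewrite scale1r addr0 rmorph1 mul1r => /eqP;
     rewrite -subr_eq subrr => /eqP.
have /choice [f hf] (u : V) : exists w : V,
    nrm w <= C * nrm u /\ forall v, hdot w v = b u v.
  (* The form is antilinear in v, so it is its conjugate that is represented as a linear
     functional. *)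
  have [||||w [h1 h2 _ _]] :=
    @riesz_rep _ V (fun v c => c = Num.conj (b u v)) (C * nrm u).
  - by rewrite b0 rmorph0.
  - by move=> c x y _ _ -> ->; rewrite br rmorphD rmorphM /= conjCK.
  - by move=> x _ ->; rewrite cabs_conj.
  - by rewrite mulr_ge0// nrm_ge0.
  by exists w; split=> // v; rewrite hdotC (h1 _ _ erefl) conjCK.
have [|B BE] := @ex_linear _ V V f.
  move=> c x y; apply: hdot_ext => z.
  by rewrite hdotDl hdotZl !(hf _).2 bl.
by exists B => u; rewrite BE; case: (hf u).
Qed.

End Forms.

(** * Preimages of operator ranges *)

Section ParallelSum.
Context {R : realType} {V H : hilbertType R}.
Variables (j : {linear V -> H}) (Mj : R) (B : {linear V -> V}) (MB : R).
Hypotheses (Mj0 : 0 <= Mj) (jb : bounded_by j Mj) (MB0 : 0 <= MB) (Bb : bounded_by B MB).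

(* The set {f | j^* f \in rg B} is the range of the square root of the bounded
   operator whose quadratic form is g |-> inf_v |g - j v|^2 + |B^* v|^2. *)
Lemma operator_range_preimage :
  operator_range [set f | exists u, forall v, hdot (B u) v = hdot f (j v)].
Proof.
have [js [jjs jsb]] := adjoint_ex Mj0 jb.
have [Bs [BBs Bsb]] := adjoint_ex MB0 Bb.
have [|T TE] := @ex_linear _ V V (fun v => js (j v) + B (Bs v)).
  by move=> c x y; rewrite !linearP /= addrACA scalerDr.
have Tdot x y : hdot (T x) y = hdot (j x) (j y) + hdot (Bs x) (Bs y).
  by rewrite TE hdotDl (adjC jjs) BBs.
have TT : adjoint T T.
  by move=> x y; rewrite [RHS]hdotC !Tdot rmorphD /= -!hdotC.
have Tpos x : rdot (T x) x = nrm (j x) ^+ 2 + nrm (Bs x) ^+ 2.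
  by rewrite /rdot Tdot reD -!rdotxx.
have [||//||K [[MK MK0 Kb] KK K2]] := @sqrt_op _ _ T (Mj * Mj + MB * MB).
- by rewrite addr_ge0// mulr_ge0.
- move=> x; rewrite TE mulrDl (le_trans (nrmD _ _))// lerD// -mulrA.
    by rewrite (le_trans (jsb _))// ler_wpM2l.
  by rewrite (le_trans (Bb _))// ler_wpM2l.
- by move=> x; rewrite Tpos addr_ge0// sqr_ge0.
have Kn x : nrm (K x) ^+ 2 = nrm (j x) ^+ 2 + nrm (Bs x) ^+ 2.
  by rewrite -Tpos -K2 /rdot KK -rdotxx.
(* Since |j v| <= |K v|, the assignment K v |-> j v is a contraction on the range of [K]; [Z] is its
   dual. *)
have [||||Z [Zb ZE _ Zc]] := @graph_dual _ V H
  (fun x y => exists2 v, x = K v & y = j v) 1.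
- by exists 0; rewrite linear0.
- move=> c _ _ _ _ [v -> ->] [w -> ->].
  by exists (c *: v + w); rewrite linearP.
- move=> _ _ [v -> ->]; rewrite mul1r -(@ler_pXn2r _ 2)// ?nnegrE ?nrm_ge0//.
  by rewrite Kn lerDl sqr_ge0.
- exact: ler01.
have {}ZE g v : hdot (K v) (Z g) = hdot (j v) g by apply: ZE; exists v.
have [Zs [ZZs Zsb]] := adjoint_ex ler01 Zb.
(* The quadratic form of Q = 1 - Z^* Z is the infimum to be represented, and [S] below is its square
   root. *)
have [|Q QE] := @ex_linear _ H H (fun g => g - Zs (Z g)).
  by move=> c x y; rewrite !linearP /= addrACA scalerDr.
have [||||S [[MS MS0 Sb] SS S2]] := @sqrt_op _ _ Q 2.
- by [].
- move=> x; rewrite QE (le_trans (nrmB _ _))// mulr_natl mulr2n lerD2l.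
  by have := Zsb (Z x); rewrite mul1r => /le_trans; apply; rewrite -[leRHS]mul1r.
- by move=> x y; rewrite !QE hdotBl hdotBr (adjC ZZs) ZZs.
- move=> x; rewrite QE rdotBl (rdot_adj (adjC ZZs)) !rdotxx subr_ge0.
  by rewrite ler_sqr ?nnegrE ?nrm_ge0// -[leRHS]mul1r.
have Sn g : nrm (S g) ^+ 2 = nrm g ^+ 2 - nrm (Z g) ^+ 2.
  by rewrite -rdotxx -(rdot_adj SS) S2 QE rdotBl (rdot_adj (adjC ZZs)) !rdotxx.
(* Completing the square: the last term can be made arbitrarily small, because [Z g] is in the
   closure of the range of [K]. *)
have Sid g v : nrm (g - j v) ^+ 2 + nrm (Bs v) ^+ 2 =
    nrm (S g) ^+ 2 + nrm (K v - Z g) ^+ 2.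
  have e : rdot (K v) (Z g) = rdot g (j v).
    by rewrite /rdot ZE -/(rdot _ _) rdotC.
  by rewrite Sn !nrmB2 Kn e; ring.
exists S; split; first by apply/bounded_operatorP; exists MS.
apply/seteqP; split=> f /=.
(* If j^* f = B u, then (f | g) = (f | g - j v) + (u | B^* v); choosing v nearly minimal bounds this
   by a multiple of |S g|, so f is in the range of [S]. *)
- move=> [u hu]; have [|||w <-] := @range_adjoint _ _ _ S S f (nrm f + nrm u).
  + by rewrite addr_ge0 ?nrm_ge0.
  + exact: SS.
  + move=> g; apply: (@le_eps_scaled _ _ _ (nrm f + nrm u)).
      by rewrite addr_ge0 ?nrm_ge0.
    move=> e e0; have [_ [_ [[v -> _] ve]]] := Zc g _ e0.
    have hS : Num.max (nrm (g - j v)) (nrm (Bs v)) <= nrm (S g) + e.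
      have h : nrm (g - j v) ^+ 2 + nrm (Bs v) ^+ 2 <= (nrm (S g) + e) ^+ 2.
        rewrite Sid sqrrD -addrA lerD2l ler_wpDl//.
          by rewrite mulrn_wge0// mulr_ge0 ?nrm_ge0 ?ltW.
        by rewrite ler_sqr ?nnegrE ?nrm_ge0 ?ltW.
      have p : 0 <= nrm (S g) + e by rewrite addr_ge0 ?nrm_ge0 ?ltW.
      rewrite ge_max; apply/andP; split.
        rewrite -(@ler_pXn2r _ 2)// ?nnegrE ?nrm_ge0// (le_trans _ h)//.
        by rewrite lerDl sqr_ge0.
      rewrite -(@ler_pXn2r _ 2)// ?nnegrE ?nrm_ge0// (le_trans _ h)//.
      by rewrite lerDr sqr_ge0.
    move: hS; rewrite ge_max => /andP[h1 h2].
    have -> : hdot f g = hdot f (g - j v) + hdot u (Bs v).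
      by rewrite -BBs hu -hdotDr subrK.
    rewrite (le_trans (cabsD _ _))// (le_trans (lerD (hdot_le _ _) (hdot_le _ _)))//.
    have -> : (nrm f + nrm u) * nrm (S g) + e * (nrm f + nrm u) =
        nrm f * (nrm (S g) + e) + nrm u * (nrm (S g) + e) by ring.
    by rewrite lerD// ler_wpM2l ?nrm_ge0.
  + by exists w.
(* Conversely, the identity at g = j v gives |S j v| <= |B^* v|, which places j^* S h in the range
   of [B]. *)
- move=> [h _ <-].
  have [|||u uE] := @range_adjoint _ _ _ B Bs (js (S h)) (nrm h).
  + exact: nrm_ge0.
  + exact: BBs.
  + move=> v; rewrite (adjC jjs) SS (le_trans (hdot_le _ _))// ler_wpM2l ?nrm_ge0//.
    rewrite -(@ler_pXn2r _ 2)// ?nnegrE ?nrm_ge0//.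
    have := Sid (j v) v; rewrite subrr nrm0 expr0n add0r => ->.
    by rewrite lerDl sqr_ge0.
  + by exists u => v; rewrite uE (adjC jjs).
Qed.

End ParallelSum.

Section RangeOfForm.
Context {R : realType} {H : hilbertType R} (A : operator H).

Lemma generated_operator_range :
  generated_by_accretive_form A -> operator_range (range_id_plus A).
Proof.
move=> [V [j [a [/bounded_operatorP [Mj Mj0 jb] dj ca _ [domA assA]]]]].
have [C C0 aC] := form_continuous_bd ca.
have [||||B Bb BE] := @form_operator _ V
  (fun u v => a u v + hdot (j u) (j v)) (C + Mj * Mj).
- by rewrite addr_ge0// mulr_ge0.
- move=> c x y z; rewrite linearPl linearP hdotDl hdotZl /=.
  by ring.
- move=> c x y z; rewrite linearPr linearP hdotDr hdotZr /=.
  by ring.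
- move=> u v; rewrite (le_trans (cabsD _ _))// !mulrDl lerD//.
  rewrite (le_trans (hdot_le _ _))//.
  have -> : Mj * Mj * nrm u * nrm v = (Mj * nrm u) * (Mj * nrm v) by ring.
  by rewrite ler_pM ?nrm_ge0.
have C1 : 0 <= C + Mj * Mj by rewrite addr_ge0// mulr_ge0.
have [S [Sb SE]] := operator_range_preimage Mj0 jb C1 Bb.
exists S; split=> //; rewrite -SE; apply/seteqP; split=> f /=.
- move=> [x]; rewrite domA => -[u Du <-] <-; exists u => v.
  by rewrite BE assA// hdotDl addrC.
- move=> [u hu].
  have Du : form_domain a j u.
    by exists (f - j u) => v; rewrite hdotBl -hu BE addrK.
  (* Both vectors represent a(u, .) on the range of [j], whose density identifies them. *)
  have AE : A (j u) = f - j u.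
    apply/eqP; rewrite -subr_eq0; apply/eqP/(dense_orth dj) => _ [v _ <-].
    by rewrite hdotBl -assA// hdotBl -hu BE addrK subrr.
  exists (j u); first by rewrite domA; exists u.
  by rewrite AE addrC subrK.
Qed.

End RangeOfForm.

(** * Square-summable sequences *)

Section ComplexSeries.
Context {R : realType}.
Implicit Types (c d : nat -> R[i]) (s t k : R[i]).

Definition has_csum c s :=
  (fun N => cabs (\sum_(n < N) c n - s)) @ \oo --> (0 : R).

Lemma has_csum_uniq c s t : has_csum c s -> has_csum c t -> s = t.
Proof.
move=> cs ct; apply/eqP; rewrite -subr_eq0; apply/eqP/cabs0_eq0.
have h : (fun=> cabs (s - t)) @ \oo --> (0 : R).
  apply: squeeze0 (cvg0D cs ct) _ => n; rewrite cabs_ge0 /=.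
  set S := \sum_(i < n) _.
  have -> : s - t = - (S - s) + (S - t) by ring.
  by rewrite (le_trans (cabsD _ _))// normcN.
exact: cvg0_cst h.
Qed.

Lemma has_csumP k c d s t : has_csum c s -> has_csum d t ->
  has_csum (fun n => k * c n + d n) (k * s + t).
Proof.
move=> cs dt; apply: squeeze0 (cvg0D (cvg0Z (cabs k) cs) dt) _ => n.
rewrite cabs_ge0 /= big_split -mulr_sumr /= opprD addrACA -mulrBr.
by rewrite (le_trans (cabsD _ _))// ComplexField.Normc.normcM.
Qed.

Lemma has_csum_conj c s : has_csum c s ->
  has_csum (fun n => Num.conj (c n)) (Num.conj s).
Proof.
move=> cs; apply: squeeze0 cs _ => n.
by rewrite cabs_ge0 /= -rmorph_sum -rmorphB /= cabs_conj.
Qed.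

Lemma real_series_ex (r b : nat -> R) (M : R) : (forall n, `|r n| <= b n) ->
  (forall N, \sum_(n < N) b n <= M) ->
  exists s : R, (fun N => `|\sum_(n < N) r n - s|) @ \oo --> (0 : R).
Proof.
move=> rb bM.
have : cvgn (series r).
  apply: normed_cvg; apply: nondecreasing_is_cvgn.
    apply/nondecreasing_seqP => n.
    by rewrite /normed_series_of /series /= [leRHS]big_nat_recr /= ?lerDl.
  exists M => _ [N _ <-]; rewrite /normed_series_of /series /= big_mkord (le_trans _ (bM N))//.
  by apply: ler_sum => i _; exact: rb.
move=> /cvg_ex [s rs]; exists s.
apply/cvg0_eps => [n|e e0]; first exact: normr_ge0.
move/cvgrPdist_lt : rs => /(_ e e0) [N _ hN]; exists N => n Nn.
by have := hN n Nn; rewrite /series /= big_mkord distrC.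
Qed.

(** Each squared term is the difference of two consecutive partial sums, both close to the limit. *)
Lemma sum_sqr_cvg0 (a : nat -> R) (M : R) : (forall n, 0 <= a n) ->
  (forall N, \sum_(n < N) a n ^+ 2 <= M) -> a @ \oo --> 0.
Proof.
move=> a0 aM; have [|s hs] := @real_series_ex (fun n => a n ^+ 2) (fun n => a n ^+ 2) M _ aM.
  by move=> n; rewrite ger0_norm// sqr_ge0.
apply/(cvg0_eps a0) => e e0.
have p n : 0 <= `|\sum_(i < n) a i ^+ 2 - s| by [].
have [|N hN] := (cvg0_eps p).2 hs (e ^+ 2 / 2).
  by rewrite divr_gt0// exprn_gt0.
exists N => n Nn; rewrite -(@ltr_pXn2r _ 2)// ?nnegrE ?(ltW e0)//.
have h1 := hN _ Nn; have h2 := hN _ (leqW Nn).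
rewrite big_ord_recr /= in h2; set S := \sum_(i < n) _ in h1 h2.
rewrite -[a n ^+ 2]ger0_norm ?sqr_ge0//.
have -> : a n ^+ 2 = (S + a n ^+ 2 - s) - (S - s) by ring.
by rewrite (le_lt_trans (ler_normB _ _))// (splitr (e ^+ 2)) ltrD.
Qed.

Lemma cabs_le (z : R[i]) : cabs z <= `|re z| + `|im z|.
Proof.
rewrite -(@ler_pXn2r _ 2)// ?nnegrE ?cabs_ge0 ?addr_ge0//.
rewrite cabs2 sqrrD !real_normK ?num_real// addrAC lerDl.
by rewrite mulrn_wge0// mulr_ge0.
Qed.

Lemma normr_im_le (z : R[i]) : `|im z| <= cabs z.
Proof.
rewrite -(@ler_pXn2r _ 2)// ?nnegrE ?cabs_ge0// real_normK ?num_real// cabs2.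
by rewrite lerDr sqr_ge0.
Qed.

Lemma normr_re_le (z : R[i]) : `|re z| <= cabs z.
Proof.
rewrite -(@ler_pXn2r _ 2)// ?nnegrE ?cabs_ge0// real_normK ?num_real// cabs2.
by rewrite lerDl sqr_ge0.
Qed.

Lemma re_sum c N : re (\sum_(n < N) c n) = \sum_(n < N) re (c n).
Proof.
by elim: N => [|N IH]; rewrite ?big_ord0// !big_ord_recr /= reD IH.
Qed.

Lemma im_sum c N : im (\sum_(n < N) c n) = \sum_(n < N) im (c n).
Proof.
elim: N => [|N IH]; rewrite ?big_ord0// !big_ord_recr /= -IH.
by case: (\sum_(_ < _) _) (c N) => ? ? [].
Qed.

Lemma csum_ex c (b : nat -> R) (M : R) : (forall n, cabs (c n) <= b n) ->
  (forall N, \sum_(n < N) b n <= M) -> exists s, has_csum c s.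
Proof.
move=> cb bM.
have [|s hs] := @real_series_ex (fun n => re (c n)) b M _ bM.
  by move=> n; rewrite (le_trans (normr_re_le _)).
have [|t ht] := @real_series_ex (fun n => im (c n)) b M _ bM.
  by move=> n; rewrite (le_trans (normr_im_le _)).
exists (s +i* t); apply: squeeze0 (cvg0D hs ht) _ => n.
rewrite cabs_ge0 /= (le_trans (cabs_le _))//.
rewrite -re_sum -im_sum; case: (\sum_(_ < _) _) => x y /=.
by [].
Qed.

Lemma has_csum_ge0 (w : nat -> R) s : (forall n, 0 <= w n) ->
  has_csum (fun n => (w n)%:C) s ->
  s = (re s)%:C /\ forall N, \sum_(n < N) w n <= re s.
Proof.
move=> w0 ws.
have im0 N : im (\sum_(n < N) (w n)%:C) = 0 by rewrite (im_sum (fun n => (w n)%:C)) big1.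
split.
  have : (fun=> `|im s|) @ \oo --> (0 : R).
    apply: squeeze0 ws _ => n; rewrite normr_ge0 /=.
    apply: le_trans (normr_im_le _).
    have := im0 n; case: (\sum_(_ < _) _) => x y /= ->.
    by case: s => a b /=; rewrite add0r normrN.
  by move=> /cvg0_cst /normr0_eq0; case: s {ws} => a b /= ->.
move=> N; apply/ler_addgt0Pr => e e0.
have [N' hN'] := (cvg0_eps (fun n => cabs_ge0 _)).2 ws _ e0.
have := hN' (N + N')%N (leq_addl _ _).
move/(le_lt_trans (normr_re_le _)).
have -> : re (\sum_(n < N + N') (w n)%:C - s) = \sum_(n < N + N') w n - re s.
  by rewrite reD reN (re_sum (fun n => (w n)%:C)).
move=> /ltr_normlW; rewrite ltrBlDr => /ltW h.
rewrite addrC (le_trans _ h)// big_split_ord /= lerDl.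
by apply: sumr_ge0.
Qed.

Lemma has_csum_le (w : nat -> R) s (M : R) :
  has_csum (fun n => (w n)%:C) s -> (forall N, \sum_(n < N) w n <= M) ->
  re s <= M.
Proof.
move=> ws wM; apply/ler_addgt0Pr => e e0.
have [N hN] := (cvg0_eps (fun n => cabs_ge0 _)).2 ws _ e0.
have := hN N (leqnn _); move/(le_lt_trans (normr_re_le _)).
have -> : re (\sum_(n < N) (w n)%:C - s) = \sum_(n < N) w n - re s.
  by rewrite reD reN (re_sum (fun n => (w n)%:C)).
rewrite distrC => /ltr_normlW; rewrite ltrBlDr => /ltW h.
by rewrite (le_trans h)// addrC lerD2r wM.
Qed.

Lemma has_csum_single c (m : nat) : (forall n, n != m -> c n = 0) ->
  has_csum c (c m).
Proof.
move=> c0; apply/cvg0_eps => [n|e e0]; first exact: cabs_ge0.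
exists m.+1 => n mn; rewrite (bigD1 (Ordinal mn))//= big1 ?addr0.
  by rewrite subrr ComplexField.Normc.normc0.
by move=> i im; apply: c0; apply: contra_neq im => im; exact: val_inj.
Qed.

End ComplexSeries.

(** * Triangle inequality and a sequential criterion for completeness *)

Section DotTriangle.
Context {C : numClosedFieldType} {U : lmodType C} (f : {dot U for Num.conj}).

(** Stated for a bare dot product because it supplies the norm axiom of [l2], which is not yet
    normed at that point. Cauchy-Schwarz is again positivity at b u - a v. *)
Lemma dot_triangle (u v : U) :
  sqrtC (f (u + v) (u + v)) <= sqrtC (f u u) + sqrtC (f v v).
Proof.
set a := sqrtC (f u u); set b := sqrtC (f v v).
have a0 : 0 <= a by rewrite sqrtC_ge0 dnorm_ge0.
have b0 : 0 <= b by rewrite sqrtC_ge0 dnorm_ge0.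
have au : f u u = a ^+ 2 by rewrite sqrtCK.
have bv : f v v = b ^+ 2 by rewrite sqrtCK.
rewrite -[leRHS]sqrCK ?addr_ge0// ler_sqrtC ?nnegrE ?dnorm_ge0 ?exprn_ge0 ?addr_ge0//.
rewrite dnormD au bv sqrrD [leRHS]addrAC lerD2l.
have [a00|a00] := eqVneq a 0.
  have /eqP : f u u = 0 by rewrite au a00 expr0n.
  by rewrite dnorm_eq0 => /eqP ->; rewrite linear0l rmorph0 addr0 mulrn_wge0 ?mulr_ge0.
have [b00|b00] := eqVneq b 0.
  have /eqP : f v v = 0 by rewrite bv b00 expr0n.
  by rewrite dnorm_eq0 => /eqP ->; rewrite linear0r rmorph0 addr0 mulrn_wge0 ?mulr_ge0.
have ab : 0 < a * b by rewrite mulr_gt0// lt_def ?a00 ?b00.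
have := dnorm_ge0 f (b *: u - a *: v).
have Zl c x z : f (c *: x) z = c * f x z by exact: linearZl_LR.
have Zr c x z : f z (c *: x) = Num.conj c * f z x by exact: linearZr_LR.
rewrite dnormB !dnormZ !ger0_norm// au bv Zl Zr !rmorphM /=.
rewrite !(geC0_conj a0) (geC0_conj b0).
move=> h; rewrite -(ler_pM2l ab) -subr_ge0.
by apply: le_trans h _; rewrite le_eqVlt; apply/orP; left; apply/eqP; rewrite -mulr_natl; ring.
Qed.

End DotTriangle.

Section SequentialCompleteness.
Context {R : realType} {V : normedModType R[i]}.

(** Points whose balls of radius 1 / (n + 1) belong to a Cauchy filter form a Cauchy sequence; its
    limit is a limit of the filter. *)
Lemma seq_complete :
  (forall x : nat -> V, (forall e : R, 0 < e -> exists N, forall m n,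
      (N <= m)%N -> (N <= n)%N -> re `|x m - x n| < e) ->
    exists l, forall e : R, 0 < e -> exists N, forall n, (N <= n)%N ->
      re `|x n - l| < e) ->
  forall F : set_system V, ProperFilter F -> cauchy F -> cvg F.
Proof.
move=> sc F PF /cauchyP cF.
have hp n : 0 < (harmonic n)%:C :> R[i] by rewrite ltcR invr_gt0.
have /choice [x xF] n : exists y, F (ball y (harmonic n)%:C) by exact: cF.
pose nv (z : V) : R := re `|z|.
have nvE z : `|z| = (nv z)%:C by rewrite RRe_real// ger0_real.
have nvC p q : nv (p - q) = nv (q - p) by rewrite /nv distrC.
have dist (p q r : V) : nv (p - q) <= nv (p - r) + nv (q - r).
  by have := ler_distD r p q; rewrite (distrC r q) !nvE -rmorphD lecR.
have hs (e : R) : 0 < e -> exists N, forall n, (N <= n)%N -> harmonic n < e :> R.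
  have p n : 0 <= harmonic n :> R by rewrite invr_ge0.
  exact: (cvg0_eps p).2 cvg_harmonic e.
have [|l hl] := sc x.
  move=> e e0; have [|N hN] := hs (e / 2); first by rewrite divr_gt0.
  exists N => m n Nm Nn.
  have [z [mz nz]] := filter_ex (filterI (xF m) (xF n)).
  move: mz nz; rewrite -!ball_normE /= !nvE !ltcR => mz nz.
  rewrite -/(nv _) (le_lt_trans (dist _ _ z))// (splitr e) ltrD//.
    exact: lt_trans mz (hN _ Nm).
  exact: lt_trans nz (hN _ Nn).
apply/cvg_ex; exists l; apply/cvgrPdist_lt => e.
rewrite ltcE /= => /andP[/eqP ie e0]; set r := re e in e0.
have [|N hN] := hs (r / 2); first by rewrite divr_gt0.
have [|N' hN'] := hl (r / 2); first by rewrite divr_gt0.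
pose n := maxn N N'.
apply: filterS (xF n) => z; rewrite -ball_normE /= !nvE ltcR => nz.
rewrite ltcE /= ie eqxx /= (le_lt_trans (dist _ _ (x n)))//.
rewrite (splitr (re e)) ltrD//.
  by rewrite nvC; exact: hN' (leq_maxr _ _).
by rewrite nvC; exact: lt_trans nz (hN _ (leq_maxl _ _)).
Qed.

End SequentialCompleteness.

Lemma eq_has_csum {R : realType} (c d : nat -> R[i]) s : has_csum c s -> c =1 d ->
  has_csum d s.
Proof. by move=> h /funext <-. Qed.

(** * Hilbert space structure on square-summable sequences *)

Section L2.
Variables (R : realType) (H : hilbertType R) (D : nat -> set H).

(* The closed subspace containing the [n]-th terms is presented as an orthogonal
   complement, that of [D n]. *)
Definition l2pred : {pred nat -> H} := fun x =>
  `[< (forall n, orthogonal_complement (D n) (x n)) /\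
      exists M : R, forall N, \sum_(n < N) nrm (x n) ^+ 2 <= M >].

Lemma l2pred_submod : submod_closed l2pred.
Proof.
split.
  apply/asboolP; split=> [n x _|]; first by rewrite hdot0l.
  by exists 0 => N; rewrite big1// => i _; rewrite nrm0 expr0n.
move=> c x y /asboolP [xD [Mx xM]] /asboolP [yD [My yM]].
apply/asboolP; split.
  by move=> n z Dz; rewrite /= hdotDl hdotZl xD// yD// mulr0 addr0.
exists (2 * (cabs c ^+ 2 * Mx + My)) => N.
have le n : nrm ((c *: x + y) n) ^+ 2 <=
    2 * (cabs c ^+ 2 * nrm (x n) ^+ 2 + nrm (y n) ^+ 2).
  have := nrmD (c *: x n) (y n); rewrite nrmZ => h.
  have := sqr_ge0 (cabs c * nrm (x n) - nrm (y n)).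
  have : nrm (c *: x n + y n) ^+ 2 <= (cabs c * nrm (x n) + nrm (y n)) ^+ 2.
    by rewrite ler_sqr ?nnegrE ?addr_ge0 ?mulr_ge0 ?nrm_ge0 ?cabs_ge0.
  rewrite -exprMn; change ((c *: x + y) n) with (c *: x n + y n).
  by move: (cabs c * nrm (x n)) (nrm (y n)) (nrm _) => p q r h1 h2; clear -h1 h2; lra.
apply: (@le_trans _ _ (\sum_(i < N)
    2 * (cabs c ^+ 2 * nrm (x i) ^+ 2 + nrm (y i) ^+ 2))).
  by apply: ler_sum => i _; exact: le.
rewrite -mulr_sumr big_split /= -mulr_sumr ler_wpM2l// lerD//.
  by rewrite ler_wpM2l ?sqr_ge0 ?xM.
exact: yM.
Qed.

HB.instance Definition _ := GRing.isSubmodClosed.Build R[i] (nat -> H) l2pred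
  l2pred_submod.

Record l2 := L2 { l2val :> nat -> H; l2valP : l2val \in l2pred }.

HB.instance Definition _ := [isSub for l2val].
HB.instance Definition _ := [Choice of l2 by <:].
HB.instance Definition _ := [SubChoice_isSubLmodule of l2 by <:].

Implicit Types x y z : l2.

Lemma l2E c x y n : (c *: x + y) n = c *: x n + y n.
Proof. by []. Qed.

Lemma l2B x y n : (x - y) n = x n - y n.
Proof. by []. Qed.

Lemma l2_orth x n : orthogonal_complement (D n) (x n).
Proof. by have /asboolP [h _] := l2valP x; exact: h. Qed.

Lemma l2_sum x : exists M : R, forall N, \sum_(n < N) nrm (x n) ^+ 2 <= M.
Proof. by have /asboolP [_ h] := l2valP x; exact: h. Qed.

(** The default value 0 never matters: [ldotP] shows that the sum exists, as |(x_n | y_n)| <=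
    |x_n|^2 + |y_n|^2. *)
Definition ldot x y : R[i] :=
  xget 0 [set s | has_csum (fun n => hdot (x n) (y n)) s].

Lemma ldotP x y : has_csum (fun n => hdot (x n) (y n)) (ldot x y).
Proof.
rewrite /ldot; case: xgetP => [s _ //|h]; exfalso.
have [Mx xM] := l2_sum x; have [My yM] := l2_sum y.
have [||s hs] := @csum_ex R (fun n => hdot (x n) (y n))
  (fun n => nrm (x n) ^+ 2 + nrm (y n) ^+ 2) (Mx + My).
- move=> n; rewrite (le_trans (hdot_le _ _))//.
  have := sqr_ge0 (nrm (x n) - nrm (y n)).
  have := sqr_ge0 (nrm (x n)); have := sqr_ge0 (nrm (y n)).
  by move: (nrm (x n)) (nrm (y n)) => p q h1 h2 h3; clear -h1 h2 h3; lra.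
- by move=> N; rewrite big_split lerD.
exact: h hs.
Qed.

Lemma ldot_uniq x y s : has_csum (fun n => hdot (x n) (y n)) s -> ldot x y = s.
Proof. exact: has_csum_uniq (ldotP x y). Qed.

Lemma ldot_bilinear : bilinear_for
  ( *%R : GRing.Scale.law R[i] R[i]) (Num.conj \; *%R : GRing.Scale.law R[i] R[i]) ldot.
Proof.
split=> [z c x y|z c x y] /=; apply: ldot_uniq.
  apply: eq_has_csum (has_csumP c (ldotP x z) (ldotP y z)) _ => n.
  by rewrite l2E hdotDl hdotZl.
apply: eq_has_csum (has_csumP (Num.conj c) (ldotP z x) (ldotP z y)) _ => n.
by rewrite l2E hdotDr hdotZr.
Qed.

HB.instance Definition _ := bilinear_isBilinear.Build R[i] l2 l2 R[i]
  ( *%R : GRing.Scale.law R[i] R[i]) (Num.conj \; *%R : GRing.Scale.law R[i] R[i])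
  ldot ldot_bilinear.

Lemma ldot_herm x y : ldot x y = (-1) ^+ false * Num.conj (ldot y x).
Proof.
rewrite mul1r; apply: ldot_uniq.
by apply: eq_has_csum (has_csum_conj (ldotP y x)) _ => n; rewrite -hdotC.
Qed.

HB.instance Definition _ := isHermitianSesquilinear.Build R[i] l2 false
  (@Num.conj R[i]) ldot ldot_herm.

Lemma ldot_csum x : has_csum (fun n => (nrm (x n) ^+ 2)%:C) (ldot x x).
Proof.
by apply: eq_has_csum (ldotP x x) _ => n; rewrite hdotxx.
Qed.

Lemma ldotxx x : ldot x x = (re (ldot x x))%:C.
Proof. by case: (has_csum_ge0 (fun n => sqr_ge0 _) (ldot_csum x)). Qed.

Lemma ldot_sum x N : \sum_(n < N) nrm (x n) ^+ 2 <= re (ldot x x).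
Proof. by case: (has_csum_ge0 (fun n => sqr_ge0 _) (ldot_csum x)). Qed.

Lemma ldot_coord x n : nrm (x n) ^+ 2 <= re (ldot x x).
Proof.
apply: le_trans (ldot_sum x n.+1); rewrite big_ord_recr /= lerDr.
by apply: sumr_ge0 => i _; exact: sqr_ge0.
Qed.

Lemma ldot_gt0 x : x != 0 -> 0 < ldot x x.
Proof.
move=> x0; rewrite ldotxx ltcR; rewrite lt_def (le_trans (sqr_ge0 _) (ldot_coord x 0%N)) andbT.
apply: contra_neq x0 => h; apply: val_inj; apply/funext => n.
have := ldot_coord x n; rewrite h => h'.
have /eqP : nrm (x n) ^+ 2 = 0 by apply/eqP; rewrite eq_le h' sqr_ge0.
by rewrite sqrf_eq0 => /eqP /nrm_eq0.
Qed.

HB.instance Definition _ := isDotProduct.Build R[i] l2 ldot ldot_gt0.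

Definition lnorm x : R[i] := sqrtC (ldot x x).

Lemma lnormZ c x : lnorm (c *: x) = `|c| * lnorm x.
Proof.
have -> : lnorm (c *: x) = sqrtC (`|c| ^+ 2 * ldot x x).
  by rewrite /lnorm (dnormZ ldot).
rewrite rootCMl ?exprn_ge0// sqrCK//.
Qed.

Lemma lnorm_eq0 x : lnorm x = 0 -> x = 0.
Proof. by move/eqP; rewrite (sqrt_dnorm_eq0 ldot) => /eqP. Qed.

HB.instance Definition _ := Lmodule_isNormed.Build R[i] l2
  (dot_triangle ldot) lnormZ lnorm_eq0.

Lemma l2_hdotE x : ldot x x = `|x| ^+ 2.
Proof. by rewrite -[RHS]/(lnorm x ^+ 2) sqrtCK. Qed.

Let nm x : R := re `|x|.

Let nm2 x : nm x ^+ 2 = re (ldot x x).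
Proof.
rewrite l2_hdotE expr2 reM /nm.
by rewrite (_ : im `|x| = 0) ?mul0r ?subr0 ?expr2// ger0_Im.
Qed.

Let nm_ge0 x : 0 <= nm x.
Proof. by rewrite /nm -ler0c RRe_real// ger0_real. Qed.

Lemma l2_seq_complete (x : nat -> l2) :
  (forall e : R, 0 < e -> exists N, forall m n,
      (N <= m)%N -> (N <= n)%N -> re `|x m - x n| < e) ->
  exists l, forall e : R, 0 < e -> exists N, forall n, (N <= n)%N ->
    re `|x n - l| < e.
Proof.
move=> xc.
have cle y n : nrm (y n) <= nm y.
  by rewrite -(@ler_pXn2r _ 2)// ?nnegrE ?nrm_ge0// nm2 ldot_coord.
have /choice [y xy] n : exists l, hcvg (fun k => x k n) l.
  apply: hcauchy_cvg => e /xc [N hN]; exists N => i j Ni Nj.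
  by rewrite -l2B (le_lt_trans (cle _ _))// hN.
have yD n : orthogonal_complement (D n) (y n).
  by move=> d Dd; apply: (hcvg_dot_cst (xy n)) => k; exact: l2_orth.
have lim_sum k N : (fun m => \sum_(n < N) nrm (x k n - x m n) ^+ 2) @ \oo -->
    (\sum_(n < N) nrm (x k n - y n) ^+ 2 : R).
  elim: N => [|N IH].
    by under eq_fun do rewrite big_ord0; rewrite big_ord0; exact: cvg_cst.
  under eq_fun do rewrite big_ord_recr /=; rewrite big_ord_recr /=.
  apply: cvgD => //; rewrite expr2; under eq_fun do rewrite expr2.
  have h : (fun m => nrm (x k N - x m N)) @ \oo --> nrm (x k N - y N).
    exact/hcvg_nrm/hcvgB/xy/hcvg_cst.
  exact: cvgM.
(* The Cauchy estimate holds for each finite partial sum and passes to the coordinatewise limit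
   there, uniformly in the number of terms. *)
have tail e : 0 < e -> exists K, forall k, (K <= k)%N -> forall N,
    \sum_(n < N) nrm (x k n - y n) ^+ 2 <= e ^+ 2.
  move=> e0; have [K hK] := xc e e0; exists K => k Kk N.
  rewrite -(cvg_lim _ (lim_sum k N))//; apply: limr_le.
    by apply/cvg_ex; eexists; exact: lim_sum.
  exists K => // m /= Km; under eq_bigr do rewrite -l2B.
  rewrite (le_trans (ldot_sum _ _))// -nm2 ler_sqr ?nnegrE ?(ltW e0)//.
  by rewrite ltW// hK.
have [K hK] := tail 1 ltr01.
have zP : (fun n => x K n - y n) \in l2pred.
  apply/asboolP; split; last by exists (1 ^+ 2) => N; exact: hK.
  by move=> n d Dd; rewrite hdotBl (l2_orth (x K))// yD// subrr.
(* The limit sequence is square-summable because it differs from [x K] by a square-summable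
   sequence. *)
pose l := x K - L2 zP.
have lE n : l n = y n by rewrite l2B /= opprB addrC subrK.
exists l => e e0.
have [|K' hK'] := tail (e / 2); first by rewrite divr_gt0.
exists K' => n Kn; apply: (@le_lt_trans _ _ (e / 2)); last first.
  by rewrite ltr_pdivrMr// ltr_pMr// ltr1n.
rewrite -/(nm _) -(@ler_pXn2r _ 2)// ?nnegrE ?divr_ge0 ?(ltW e0)//.
rewrite nm2; apply: has_csum_le (ldot_csum _) _ => N.
by under eq_bigr do rewrite l2B lE; exact: hK'.
Qed.

HB.instance Definition _ := Uniform_isComplete.Build l2
  (seq_complete l2_seq_complete).

HB.instance Definition _ := CompleteNormedModule_isHilbert.Build R l2 l2_hdotE.

End L2.


Section L2Coordinates.
Context {R : realType} {H : hilbertType R} {D : nat -> set H}.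
Implicit Types u v : l2 D.

Lemma l2_dotP u v : has_csum (fun n => hdot (u n) (v n)) (hdot u v).
Proof. exact: ldotP. Qed.

Lemma l2_nrm_le u (M : R) : 0 <= M ->
  (forall N, \sum_(n < N) nrm (u n) ^+ 2 <= M ^+ 2) -> nrm u <= M.
Proof.
move=> M0 h; rewrite -(@ler_pXn2r _ 2)// ?nnegrE ?nrm_ge0// -rdotxx.
exact: has_csum_le (ldot_csum u) h.
Qed.

Lemma l2_sum_le u N : \sum_(n < N) nrm (u n) ^+ 2 <= nrm u ^+ 2.
Proof. by rewrite -rdotxx; exact: ldot_sum. Qed.

Lemma l2_coord_le u n : nrm (u n) <= nrm u.
Proof.
rewrite -(@ler_pXn2r _ 2)// ?nnegrE ?nrm_ge0//.
by rewrite -[X in _ <= X]rdotxx; exact: ldot_coord.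
Qed.

Lemma l2_cvg0 u : (fun n => nrm (u n)) @ \oo --> (0 : R).
Proof.
by apply: (sum_sqr_cvg0 (M := nrm u ^+ 2)) => n; [exact: nrm_ge0|exact: l2_sum_le].
Qed.

Lemma l2_ext u v : (forall n, u n = v n) -> u = v.
Proof. by move=> h; apply: val_inj; apply/funext. Qed.

Lemma l2_inj_ex (m : nat) y : orthogonal_complement (D m) y ->
  exists u : l2 D, [/\ u m = y, forall n, n != m -> u n = 0 &
    forall v, hdot v u = hdot (v m) y].
Proof.
move=> Dy; pose f n := if n == m then y else 0.
have fP : f \in l2pred D.
  apply/asboolP; split=> [n d Dd|].
    by rewrite /f; case: eqP Dd => [->|_] Dd; [exact: Dy|rewrite hdot0l].
  exists (nrm y ^+ 2) => N; elim: N => [|N IH].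
    by rewrite big_ord0 sqr_ge0.
  have [mN|Nm] := ltnP m N.+1.
    rewrite (bigD1 (Ordinal mN))//= /f eqxx big1 ?addr0// => i im.
    by rewrite ifN ?nrm0 ?expr0n//.
  rewrite big1 ?sqr_ge0// => i _; rewrite /f ifN ?nrm0 ?expr0n//.
  by rewrite neq_ltn (leq_trans (ltn_ord i) Nm).
exists (L2 fP); split=> [|n nm|v] /=; rewrite /f ?eqxx ?ifN//.
have h : has_csum (fun n => hdot (v n) (f n)) (hdot (v m) (f m)).
  apply: (has_csum_single (c := fun n => hdot (v n) (f n))) => n nm.
  by rewrite /f ifN// hdot0r.
by rewrite (has_csum_uniq (l2_dotP v (L2 fP)) h) /f eqxx.
Qed.

End L2Coordinates.

(** Serves to skip coordinate 0 of the form space, which carries w, and to sum over the coordinates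
    n + 1, which carry z_n. *)
Lemma has_csum_behead {R : realType} (c : nat -> R[i]) s :
  c 0%N = 0 -> has_csum c s -> has_csum (fun n => c n.+1) s.
Proof.
move=> c0 cs; apply/cvg0_eps => [n|e e0]; first exact: cabs_ge0.
have p n : 0 <= cabs (\sum_(i < n) c i - s) by exact: cabs_ge0.
have [N hN] := (cvg0_eps p).2 cs e e0; exists N => n Nn.
by have := hN n.+1 (leqW Nn); rewrite big_ord_recl c0 add0r.
Qed.

Lemma ex_form {R : realType} (V : hilbertType R) (f : V -> V -> R[i]) :
  (forall c x y z, f (c *: x + y) z = c * f x z + f y z) ->
  (forall c x y z, f z (c *: x + y) = Num.conj c * f z x + f z y) ->
  exists a : sesquilinear_form V, forall u v, a u v = f u v.
Proof.
move=> fl fr.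
have fb : bilinear_for ( *%R : GRing.Scale.law R[i] R[i])
    (Num.conj \; *%R : GRing.Scale.law R[i] R[i]) f.
  by split=> [z c x y|z c x y] /=; [exact: fl|exact: fr].
exists (HB.pack f (bilinear_isBilinear.Build R[i] V V R[i]
  ( *%R : GRing.Scale.law R[i] R[i])
  (Num.conj \; *%R : GRing.Scale.law R[i] R[i]) f fb) : sesquilinear_form V).
by [].
Qed.

(** With ratio 1/4 the weights after the k-th add up to only a third of it, which drives the
    injectivity argument. *)
Definition weight {R : realType} (n : nat) : R := 4^-1 ^+ n.

Lemma weight_gt0 {R : realType} n : 0 < weight n :> R.
Proof. by rewrite exprn_gt0// invr_gt0. Qed.

Lemma weight_le1 {R : realType} n : weight n <= 1 :> R.
Proof. by rewrite exprn_ile1// ?invr_ge0// invf_le1// ler1n. Qed.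

Lemma sum_weight2_le {R : realType} (N : nat) : \sum_(n < N) weight n ^+ 2 <= 2 :> R.
Proof.
(* The strengthened bound leaves room for the next summand in the induction. *)
suff : \sum_(n < N) weight n ^+ 2 <= 2 - 2 * weight N ^+ 2 :> R.
  by move/le_trans; apply; rewrite gerDl oppr_le0 mulr_ge0// sqr_ge0.
elim: N => [|N IH]; first by rewrite big_ord0 /weight expr0 expr1n mulr1 subrr.
rewrite big_ord_recr /= [weight N.+1]exprS -/(weight N).
have := sqr_ge0 (weight N : R); rewrite exprMn.
by move: IH; move: (weight N ^+ 2) (\sum_(_ < _) _) => p S h1 h2; clear -h1 h2; lra.
Qed.

(** * The generating form *)

Section FormConstruction.
Context {R : realType} {H : hilbertType R}.
Variables (A : operator H) (R0 : {linear H -> H}) (MR : R).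
Hypotheses (hA : accretive A) (MR0 : 0 <= MR) (R0b : bounded_by R0 MR).
Hypothesis rgA : range_id_plus A = range R0.

Let E := orthogonal_complement (odom A).

Lemma oper0 : A 0 = 0.
Proof.
have := oper_linear 1 (odom0 A) (odom0 A).
by rewrite !scale1r addr0 => /eqP; rewrite -subr_eq subrr => /eqP.
Qed.

(** Accretivity gives |x|^2 <= Re (x + A x | x). Hence I + A is injective with contractive
    inverse. *)
Lemma oper_inj_bound x : odom A x -> nrm x <= nrm (x + A x).
Proof.
move=> Ax; have [->|x0] := eqVneq (nrm x) 0; first exact: nrm_ge0.
have {}x0 : 0 < nrm x by rewrite lt_def x0 nrm_ge0.
rewrite -(ler_pM2r x0); apply: le_trans (rdot_le _ _).
by rewrite /rdot hdotDl reD -/(rdot x x) rdotxx -expr2 lerDl hA.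
Qed.

(** [J0] is (I + A)^-1 R0; its values are chosen pointwise, and injectivity of I + A makes the
    choice linear. *)
Lemma resolvent_ex : exists2 J0 : {linear H -> H}, bounded_by J0 MR &
  forall w, odom A (J0 w) /\ J0 w + A (J0 w) = R0 w.
Proof.
have /choice [f hf] w : exists x, odom A x /\ x + A x = R0 w.
  have : range_id_plus A (R0 w) by rewrite rgA; exists w.
  by move=> [x Ax <-]; exists x.
have [|J0 JE] := @ex_linear _ H H f.
  move=> c x y.
  have [[[d1 e1] [d2 e2]] [d3 e3]] := (hf (c *: x + y), hf x, hf y).
  have dl : odom A (c *: f x + f y) by exact: odom_linear.
  have dd : odom A (-1 *: (c *: f x + f y) + f (c *: x + y)).
    exact: odom_linear.
  have := oper_inj_bound dd; rewrite oper_linear// oper_linear// addrACA e1.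
  rewrite -scalerDr addrACA -scalerDr e2 e3 (linearP R0) !scaleN1r addNr nrm0 => h.
  have /nrm_eq0 : nrm (- (c *: f x + f y) + f (c *: x + y)) = 0.
    by apply/eqP; rewrite eq_le h nrm_ge0.
  by move/eqP; rewrite addrC subr_eq0 => /eqP.
exists J0 => w; rewrite JE; last exact: hf.
have [d e] := hf w; rewrite (le_trans (oper_inj_bound d))// e.
exact: R0b.
Qed.

(** Here w ranges over [K] and each z_n over [F]. [RK] allows [K] to be the complement of the kernel
    of [R0]. [Tsep] asks for the separation property on all null sequences, which include the
    square-summable ones. *)
Variables (DK DF : set H) (T : nat -> {linear H -> H}) (C : R).
Let K := orthogonal_complement DK.
Let F := orthogonal_complement DF.
Hypothesis RK : forall w, exists2 w', K w' & R0 w' = R0 w.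
Hypotheses (C0 : 0 <= C) (Tb : forall n, bounded_by (T n) C).
Hypothesis TE : forall n y, F y -> E (T n y).
Hypothesis Tsep : forall x (z : nat -> H),
  (fun n => nrm (z n)) @ \oo --> (0 : R) -> (forall n, F (z n)) ->
  (forall n y, F y -> hdot (z n) y = hdot x (T n y)) ->
  forall e, E e -> hdot x e = 0.

(** Coordinate 0 holds w, coordinate n + 1 holds z_n. *)
Let V := l2 (fun n => if n is 0%N then DK else DF).

Let vF (u : V) n : F (u n.+1).
Proof. exact: (@l2_orth _ _ _ u n.+1). Qed.

(** [j1] is obtained as the adjoint of x |-> (4^-n P T_n^* x)_n, where the projection [P] onto [F]
    puts the sequence into [V]; no vector-valued series has to be summed. *)
Lemma weighted_sum_operator_ex : exists (j1 : {linear V -> H}), [/\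
  exists2 M : R, 0 <= M & bounded_by j1 M,
  forall (u : V) x,
    has_csum (fun n => (weight n)%:C * hdot (T n (u n.+1)) x) (hdot (j1 u) x) &
  forall u, E (j1 u)].
Proof.
have /choice [Ts hTs] n := adjoint_ex C0 (Tb n).
have [P [Pb PF PE]] := orth_proj DF.
pose g x n := if n is m.+1 then (weight m)%:C *: P (Ts m x) else 0.
have gn x N : \sum_(n < N) nrm (g x n) ^+ 2 <= 2 * (C * nrm x) ^+ 2.
  have le m : nrm ((weight m)%:C *: P (Ts m x)) ^+ 2 <= weight m ^+ 2 * (C * nrm x) ^+ 2.
    rewrite nrmZ cabsR exprMn ger0_norm ?(ltW (weight_gt0 _))//.
    rewrite ler_wpM2l ?sqr_ge0// ler_sqr ?nnegrE ?mulr_ge0 ?nrm_ge0//.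
    by rewrite (le_trans (Pb _))// mul1r; case: (hTs m) => _ ->.
  case: N => [|N]; first by rewrite big_ord0 mulr_ge0// sqr_ge0.
  rewrite big_ord_recl /= nrm0 expr0n add0r.
  apply: (@le_trans _ _ (\sum_(i < N) weight i ^+ 2 * (C * nrm x) ^+ 2)).
    by apply: ler_sum => i _; exact: le.
  by rewrite -mulr_suml ler_wpM2r ?sqr_ge0// sum_weight2_le.
have gP x : g x \in l2pred (fun n => if n is 0%N then DK else DF).
  apply/asboolP; split=> [[|n] d Dd|]; rewrite /= ?hdot0l//.
    by rewrite hdotZl PF// mulr0.
  by exists (2 * (C * nrm x) ^+ 2) => N; exact: gn.
have [|S SE] := @ex_linear _ H V (fun x => L2 (gP x)).
  move=> c x y; apply: l2_ext => -[|n]; rewrite l2E /= ?scaler0 ?addr0//.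
  rewrite 2!linearP scalerDr; congr (_ + _).
  by rewrite !scalerA mulrC.
have Sb : bounded_by S (2 * C).
  move=> x; rewrite SE; apply: l2_nrm_le => [|N].
    by rewrite !mulr_ge0// nrm_ge0.
  rewrite (le_trans (gn x N))// -mulrA [in leRHS]exprMn ler_wpM2r ?sqr_ge0//.
  by rewrite expr2 ler_peMl// ler1n.
have C20 : 0 <= 2 * C by rewrite mulr_ge0.
have [j1 [Sj1 j1b]] := adjoint_ex C20 Sb.
have hj1 (u : V) x :
    has_csum (fun n => (weight n)%:C * hdot (T n (u n.+1)) x) (hdot (j1 u) x).
  have := l2_dotP u (S x); rewrite (adjC Sj1) => /has_csum_behead.
  rewrite SE /= hdot0r => /(_ erefl) h; apply: eq_has_csum h _ => n.
  rewrite hdotZr conjE /= oppr0; congr (_ * _).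
  rewrite hdotC -PE; last exact: vF.
  by rewrite -hdotC; case: (hTs n) => <-.
exists j1; split=> //; first by exists (2 * C).
move=> u d Dd; apply: (has_csum_uniq (hj1 u d)).
apply: eq_has_csum (has_csum_single (m := 0%N) (c := fun=> 0) _) _ => // n.
by rewrite (@TE n _ (@vF u n)) ?mulr0.
Qed.

Lemma weight_operator_ex : exists Dl : {linear V -> V}, [/\ bounded_by Dl 1,
  forall (u : V) n, Dl u n.+1 = (weight n)%:C *: u n.+1, forall u, Dl u 0%N = 0 &
  forall u, 0 <= rdot (Dl u) u].
Proof.
pose g (u : V) n := if n is m.+1 then (weight m)%:C *: u m.+1 else 0.
have gn (u : V) N : \sum_(n < N) nrm (g u n) ^+ 2 <= nrm u ^+ 2.
  apply: le_trans (l2_sum_le u N); apply: ler_sum => -[[|i] /= _] _.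
    by rewrite nrm0 expr0n sqr_ge0.
  rewrite ler_sqr ?nnegrE ?nrm_ge0// nrmZ cabsR ger0_norm ?(ltW (weight_gt0 _))//.
  by rewrite ler_piMl ?nrm_ge0// weight_le1.
have gP u : g u \in l2pred (fun n => if n is 0%N then DK else DF).
  apply/asboolP; split=> [[|n] d Dd|]; rewrite /= ?hdot0l//.
    by rewrite hdotZl (@vF u n) ?mulr0.
  by exists (nrm u ^+ 2) => N; exact: gn.
have [|S SE] := @ex_linear _ V V (fun x => L2 (gP x)).
  move=> c x y; apply: l2_ext => -[|n]; rewrite l2E /= ?scaler0 ?addr0//.
  rewrite scalerDr; congr (_ + _).
  by rewrite !scalerA mulrC.
exists S; split=> [u|u n|u|u]; rewrite SE //.
  by rewrite mul1r; apply: l2_nrm_le => [|N]; [exact: nrm_ge0|exact: gn].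
have h := l2_dotP (L2 (gP u)) u.
pose w n := if n is m.+1 then weight m * nrm (u m.+1) ^+ 2 else 0.
have w0 n : 0 <= w n.
  by case: n => //= n; rewrite mulr_ge0 ?sqr_ge0// ltW// weight_gt0.
have [|_ /(_ 0%N)] := @has_csum_ge0 _ w (hdot (L2 (gP u)) u) w0.
  apply: eq_has_csum h _ => -[|n] /=; first by rewrite hdot0l.
  by rewrite hdotZl hdotxx -rmorphM.
by rewrite big_ord0.
Qed.


(** Triviality of the kernel of z |-> sum_n 4^-n T_n z_n, with the series read weakly and z merely
    bounded. *)
Definition weighted_series_injective := forall z : nat -> H, (forall n, F (z n)) ->
  (exists M : R, forall n, nrm (z n) <= M) ->
  (forall x, has_csum (fun n => (weight n)%:C * hdot (T n (z n)) x) 0) ->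
  forall n, z n = 0.

Lemma form_of_family_ex : exists (j : {linear V -> H}) (a : sesquilinear_form V),
  generating_form A a j /\
  ((forall w, K w -> R0 w = 0 -> w = 0) -> weighted_series_injective -> injective j).
Proof.
have [J0 J0b J0P] := resolvent_ex.
have [j1 [[M1 M10 j1b] j1S j1E]] := weighted_sum_operator_ex.
have [Dl [Dlb DlS Dl0 Dlpos]] := weight_operator_ex.
have J0dom w : odom A (J0 w) by case: (J0P w).
have AJ0 w : A (J0 w) = R0 w - J0 w.
  by case: (J0P w) => _ <-; rewrite addrC addKr.
have [|T0 T0E] := @ex_linear _ H H (fun w => R0 w - J0 w).
  by move=> c x y; rewrite !linearP /= addrACA scalerDr.
have AT w : A (J0 w) = T0 w by rewrite T0E AJ0.
have T0b : bounded_by T0 (MR + MR).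
  move=> w; rewrite T0E (le_trans (nrmB _ _))// mulrDl lerD//.
have [|j jE] := @ex_linear _ V H (fun u : V => J0 (u 0%N) + j1 u).
  by move=> c x y; rewrite l2E !linearP /= addrACA scalerDr.
have jb : bounded_by j (MR + M1).
  move=> u; rewrite jE (le_trans (nrmD _ _))// mulrDl lerD// (le_trans (J0b _))//.
  by rewrite ler_wpM2l// l2_coord_le.
pose f (u v : V) :=
  hdot (T0 (u 0%N)) (j v) - hdot (j1 u) (T0 (v 0%N)) + hdot (Dl u) v.
have [||a aE] := @ex_form _ V f.
- move=> c x y z; rewrite /f l2E (linearP T0) (linearP j1) (linearP Dl) !hdotDl !hdotZl /=.
  by ring.
- move=> c x y z; rewrite /f l2E (linearP T0) (linearP j) !hdotDr !hdotZr /=.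
  by ring.
have MRM : 0 <= MR + M1 by rewrite addr_ge0.
have MRR : 0 <= MR + MR by rewrite addr_ge0.
have ab : form_bd a ((MR + MR) * (MR + M1) + M1 * (MR + MR) + 1).
  move=> u v.
  have T0c (w : V) : nrm (T0 (w 0%N)) <= (MR + MR) * nrm w.
    by rewrite (le_trans (T0b _))// ler_wpM2l// l2_coord_le.
  have h1 : cabs (hdot (T0 (u 0%N)) (j v)) <=
      (MR + MR) * nrm u * ((MR + M1) * nrm v).
    by rewrite (le_trans (hdot_le _ _))// ler_pM ?nrm_ge0.
  have h2 : cabs (hdot (j1 u) (T0 (v 0%N))) <= M1 * nrm u * ((MR + MR) * nrm v).
    by rewrite (le_trans (hdot_le _ _))// ler_pM ?nrm_ge0.
  have h3 : cabs (hdot (Dl u) v) <= 1 * nrm u * nrm v.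
    by rewrite (le_trans (hdot_le _ _))// ler_wpM2r ?nrm_ge0.
  have -> : ((MR + MR) * (MR + M1) + M1 * (MR + MR) + 1) * nrm u * nrm v =
      (MR + MR) * nrm u * ((MR + M1) * nrm v) + M1 * nrm u * ((MR + MR) * nrm v) +
      1 * nrm u * nrm v by ring.
  rewrite aE (le_trans (cabsD _ _))// lerD// (le_trans (cabsD _ _))// normcN.
  exact: lerD.
(* Test vectors supported in one coordinate: here the pairs (w, 0), next those with a single z_n. *)
have inj0 w : K w -> exists u : V, [/\ u 0%N = w, j1 u = 0, Dl u = 0 &
    forall v, hdot v u = hdot (v 0%N) w].
  move=> Kw; have [u [u0 un uv]] := @l2_inj_ex _ _
    (fun n => if n is 0%N then DK else DF) 0%N w Kw.
  exists u; split=> //.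
    apply: hdot_ext => x; rewrite hdot0l.
    apply: (has_csum_uniq (j1S u x)).
    apply: eq_has_csum (has_csum_single (m := 0%N) (c := fun=> 0) _) _ => // n.
    by rewrite un// linear0 hdot0l mulr0.
  by apply: l2_ext => -[|n]; rewrite ?Dl0// DlS un// scaler0.
have injn n y : F y -> exists u : V, [/\ u 0%N = 0, j1 u = (weight n)%:C *: T n y &
    forall v, hdot v u = hdot (v n.+1) y].
  move=> Fy; have [u [un u0 uv]] := @l2_inj_ex _ _
    (fun n => if n is 0%N then DK else DF) n.+1 y Fy.
  exists u; split=> //; first by rewrite u0.
  apply: hdot_ext => x; rewrite hdotZl.
  apply: (has_csum_uniq (j1S u x)).
  have h := has_csum_single (m := n)
    (c := fun m => (weight m)%:C * hdot (T m (u m.+1)) x).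
  rewrite un in h; apply: h => m mn.
  by rewrite u0 ?eqSS// linear0 hdot0l mulr0.
have wtN n : (weight n)%:C != 0 :> R[i].
  by rewrite eq_complex /= eqxx andbT gt_eqF// weight_gt0.
have dom_sub w : K w -> exists u : V, [/\ form_domain a j u, j u = J0 w & u 0%N = w].
  move=> /inj0 [u [u0 ju Du uv]]; exists u; split=> //; last by rewrite jE u0 ju addr0.
  exists (T0 w) => v; rewrite aE /f u0 ju Du !hdot0l subr0 addr0.
  by [].
have domA d : odom A d -> exists2 w, K w & J0 w = d.
  move=> Ad; have [w _ hw] : range R0 (d + A d) by rewrite -rgA; exists d.
  have [w' Kw' e] := RK w; exists w' => //.
  have [d' e'] := J0P w'.
  have dd : odom A (-1 *: d + J0 w') by exact: odom_linear.
  have := oper_inj_bound dd; rewrite oper_linear// addrACA -scalerDr e' e.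
  rewrite hw !scaleN1r addNr nrm0 => h.
  have /nrm_eq0 /eqP : nrm (- d + J0 w') = 0.
    by apply/eqP; rewrite eq_le h nrm_ge0.
  by rewrite addrC subr_eq0 => /eqP.
have sep x (u : V) : (forall n y, F y -> hdot (u n.+1) y = hdot x (T n y)) ->
    (forall n, u n.+1 = 0) /\ forall e, E e -> hdot x e = 0.
  move=> h; have hE : forall e, E e -> hdot x e = 0.
    have cu : (fun n => nrm (u n.+1)) @ \oo --> (0 : R).
      by have := l2_cvg0 u; rewrite -cvg_shiftS.
    exact: (Tsep cu (@vF u) h).
  (* Testing with y = z_n gives |z_n|^2 = (x | T_n z_n), which vanishes because T_n z_n lies in
     [E]. *)
  split=> // n; apply: hdotxx_eq0; rewrite h; last exact: vF.
  by apply: hE; apply: TE; exact: vF.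
(* Testing against a single z_n yields z_n = P T_n^* (g - T w), with P the projection onto [F], so z
   = 0; testing against (w, 0) then puts g - T w in [E], to which it is also orthogonal. *)
have domP u g : (forall v, a u v = hdot g (j v)) ->
    g = T0 (u 0%N) /\ j u = J0 (u 0%N).
  move=> hg.
  have [|un hE] := sep (g - T0 (u 0%N)) u.
    move=> n y Fy; have [v [v0 jv uv]] := injn n y Fy.
    have := hg v; rewrite aE /f v0 linear0 hdot0r subr0 uv DlS.
    rewrite jE v0 linear0 add0r jv hdotZl !hdotZr conjE /= oppr0 -mulrDr.
    move/(mulfI (wtN n)) => h; rewrite hdotBl -h; ring.
  have ju : j1 u = 0.
    apply: hdot_ext => x; rewrite hdot0l.
    apply: (has_csum_uniq (j1S u x)).
    apply: eq_has_csum (has_csum_single (m := 0%N) (c := fun=> 0) _) _ => // n.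
    by rewrite un linear0 hdot0l mulr0.
  have Du : Dl u = 0.
    by apply: l2_ext => -[|n]; rewrite ?Dl0// DlS un scaler0.
  have gE : E (g - T0 (u 0%N)).
    move=> d /domA [w Kw <-]; have [v [v0 jv Dv uv]] := inj0 w Kw.
    have := hg v; rewrite aE /f ju Du !hdot0l subr0 addr0 => h.
    rewrite hdotBl; move: h; rewrite jE v0 jv addr0 => ->.
    by rewrite subrr.
  split; last by rewrite jE ju addr0.
  apply/eqP; rewrite -subr_eq0; apply/eqP/hdotxx_eq0; exact: hE.
exists j, a; split; first split.
- by apply/bounded_operatorP; exists (MR + M1).
- apply: dense_range => g hg.
  have gE : E g.
    by move=> d /domA [w Kw <-]; have [u [_ <- _]] := dom_sub w Kw.
  apply: hdotxx_eq0; have [|_] := sep g 0; last exact.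
  move=> n y Fy; rewrite hdot0l; have [v [v0 jv _]] := injn n y Fy.
  have := hg v; rewrite jE v0 linear0 add0r jv hdotZr conjE /= oppr0.
  by move/eqP; rewrite mulf_eq0 (negPf (wtN n)) => /eqP ->.
- by apply: form_bd_continuous ab; rewrite !addr_ge0 ?mulr_ge0.
(* The real parts of (T w | j1 z) and (j1 z | T w) cancel, leaving Re (A J w | J w) and the weighted
   square sum. *)
- move=> u; rewrite aE /f jE hdotDr !reD reN -AT -!/(rdot _ _).
  rewrite (rdotC (j1 u)) addrK addr_ge0//.
  exact: hA.
- split.
  + apply/seteqP; split=> [d /domA [w Kw <-]|_ [u [g hg] <-]].
      by have [u [Du ju _]] := dom_sub w Kw; exists u.
    by have [_ ->] := domP u g hg.
  + move=> u v [g hg]; rewrite hg; have [-> ->] := domP u g hg.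
    by rewrite AT.
move=> Kinj Tinj u v juv.
suff : forall w : V, j w = 0 -> w = 0.
  move=> h; apply/eqP; rewrite -subr_eq0; apply/eqP/h.
  by rewrite linearB /= juv subrr.
move=> {u v juv} u ju.
(* [J0 w] lies in D(A) and [j1 u] in its orthogonal complement, so a vanishing sum makes both
   vanish. *)
have e : J0 (u 0%N) = - j1 u by apply/eqP; rewrite -addr_eq0 -jE ju.
have J00 : J0 (u 0%N) = 0.
  by apply: hdotxx_eq0; rewrite {1}e hdotNl j1E// oppr0.
have j10 : j1 u = 0 by apply/eqP; rewrite -oppr_eq0 -e J00.
apply: l2_ext => -[|n].
  apply: Kinj; first exact: (@l2_orth _ _ _ u 0%N).
  by have [_ <-] := J0P (u 0%N); rewrite J00 oper0 addr0.
have -> : (0 : V) n.+1 = 0 by [].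
apply: (Tinj (fun n => u n.+1)) => [m|| x]; first exact: vF.
  by exists (nrm u) => m; exact: l2_coord_le.
by have := j1S u x; rewrite j10 hdot0l.
Qed.

End FormConstruction.

(** * Orthonormal sequences and the embedded case *)

Section Complements.
Context {R : realType} {H : hilbertType R}.
Implicit Types (S : set H) (x y : H).

Lemma orthC_lin S c x y : orthogonal_complement S x ->
  orthogonal_complement S y -> orthogonal_complement S (c *: x + y).
Proof. by move=> Sx Sy z Sz; rewrite hdotDl hdotZl Sx// Sy// mulr0 addr0. Qed.

Lemma orthC0 S : orthogonal_complement S 0.
Proof. by move=> z _; rewrite hdot0l. Qed.

Lemma orthC_B S x y : orthogonal_complement S x ->
  orthogonal_complement S y -> orthogonal_complement S (x - y).
Proof.
move=> Sx Sy; rewrite addrC -scaleN1r; exact: orthC_lin.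
Qed.

End Complements.

Section Orthonormal.
Context {R : realType} {H : hilbertType R}.
Implicit Types (S : set H) (x y : H) (s : nat -> H).

Definition orthonormal_seq s := forall n m, hdot (s n) (s m) = (n == m)%:R.

(** Bessel's inequality: the partial Fourier sums satisfy |y_N|^2 = (x | y_N), so the coefficients
    are square-summable. *)
Lemma bessel_cvg0 s x : orthonormal_seq s ->
  (fun n => cabs (hdot x (s n))) @ \oo --> (0 : R).
Proof.
move=> so; pose c n := hdot x (s n).
pose y N := \sum_(n < N) c n *: s n.
have ys N m : (N <= m)%N -> hdot (y N) (s m) = 0.
  elim: N => [|N IH] Nm; rewrite /y ?big_ord0 ?hdot0l// big_ord_recr /=.
  by rewrite hdotDl IH ?(ltnW Nm)// hdotZl so ltn_eqF// mulr0 addr0.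
have xy N : hdot x (y N) = (\sum_(n < N) cabs (c n) ^+ 2)%:C.
  elim: N => [|N IH]; rewrite /y ?big_ord0 ?hdot0r// !big_ord_recr /=.
  rewrite hdotDr IH hdotZr rmorphD; congr (_ + _).
  by rewrite mulrC -normCK absE -rmorphXn.
have yy N : nrm (y N) ^+ 2 = \sum_(n < N) cabs (c n) ^+ 2.
  elim: N => [|N IH]; rewrite /y ?big_ord0 ?nrm0 ?expr0n// !big_ord_recr /=.
  rewrite nrmD2 -/(y N) IH {1}/rdot hdotZr ys// mulr0 /= mulr0 addr0.
  rewrite nrmZ exprMn; congr (_ + _).
  by rewrite -[nrm (s N) ^+ 2]rdotxx /rdot so eqxx /= mulr1.
have bes N : \sum_(n < N) cabs (c n) ^+ 2 <= nrm x ^+ 2.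
  have := sqr_ge0 (nrm (x - y N)); rewrite nrmB2 yy /rdot xy /=.
  by move: (\sum_(_ < _) _) (nrm x ^+ 2) => a b h; clear -h; lra.
by apply: (sum_sqr_cvg0 (M := nrm x ^+ 2)) => n; [exact: cabs_ge0|exact: bes].
Qed.

Lemma has_norm1 x : x != 0 -> exists2 k : R[i], k != 0 & hdot (k *: x) (k *: x) = 1.
Proof.
move=> x0; have n0 : nrm x != 0 by apply: contra_neq x0; exact: nrm_eq0.
exists (nrm x)^-1%:C; first by rewrite eq_complex /= eqxx andbT invr_eq0.
rewrite hdotxx nrmZ cabsR ger0_norm ?invr_ge0 ?nrm_ge0//.
by rewrite mulVf// expr1n.
Qed.

Variable S : set H.
Let N := orthogonal_complement S.

Fixpoint onlist (l : seq H) : Prop := if l is x :: l' then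
  [/\ N x, hdot x x = 1, forall y, y \in l' -> hdot x y = 0 & onlist l'] else True.

Lemma onlist_proj (l : seq H) y : onlist l -> N y ->
  N (y - \sum_(i <- l) hdot y i *: i) /\
  forall x, x \in l -> hdot (y - \sum_(i <- l) hdot y i *: i) x = 0.
Proof.
elim: l => [|a l IH] /=; first by rewrite big_nil subr0.
move=> [Na aa al /IH h] /h {IH h} [IN IH]; rewrite big_cons.
have -> : y - (hdot y a *: a + \sum_(i <- l) hdot y i *: i) =
  (- hdot y a) *: a + (y - \sum_(i <- l) hdot y i *: i).
  by rewrite opprD addrCA scaleNr.
split; first exact: orthC_lin.
move=> x; rewrite inE => /orP[/eqP ->|xl]; last first.
  by rewrite hdotDl hdotZl al// IH// mulr0 addr0.
rewrite hdotDl hdotZl aa mulr1 hdotBl.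
have -> : hdot (\sum_(i <- l) hdot y i *: i) a = 0; last by rewrite subr0 addNr.
elim: l al {IN IH} => [|b l IHl] al; rewrite ?big_nil ?hdot0l// big_cons.
rewrite hdotDl hdotZl IHl ?addr0; last by move=> z zl; rewrite al// inE zl orbT.
by rewrite (hdot_eq0C (al b _)) ?mulr0// inE eqxx.
Qed.

(** If the list had no extension, every Gram-Schmidt remainder would be zero and the list would span
    [N]. *)
Lemma onlist_next (l : seq H) : ~ finite_dimensional N ->
  onlist l -> exists y, onlist (y :: l).
Proof.
move=> nf ol; apply: contrapT => hn; apply: nf.
exists (size l), (fun i => nth 0 l i); split.
  move=> i; have : nth 0 l i \in l by rewrite mem_nth.
  move: (nth 0 l i) => z {i hn}; elim: l ol => //= a l IH [Na _ _ /IH h].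
  by rewrite inE => /orP[/eqP ->|].
move=> y Ny; exists (fun i => hdot y (nth 0 l i)).
have [N1 h1] := onlist_proj ol Ny.
apply/eqP; rewrite -subr_eq0.
rewrite (_ : \sum_(i < size l) _ = \sum_(i <- l) hdot y i *: i); last first.
  by rewrite (big_nth 0) big_mkord.
apply/negPn/negP => /has_norm1 [k k0 hk]; apply: hn.
exists (k *: (y - \sum_(i <- l) hdot y i *: i)) => /=; split=> // [|x xl].
  by rewrite -[k *: _]addr0; apply: orthC_lin => //; exact: orthC0.
by rewrite hdotZl h1// mulr0.
Qed.

Lemma infinite_orthonormal : ~ finite_dimensional N ->
  exists2 s, orthonormal_seq s & forall n, N (s n).
Proof.
move=> nf.
have /choice [next hnext] (l : seq H) : exists y, onlist l -> onlist (y :: l).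
  have [ol|nl] := pselect (onlist l); last by exists 0.
  by have [y hy] := onlist_next nf ol; exists y.
(* [l n] holds s_(n-1), ..., s_0, so each new vector is orthogonal to all earlier ones. *)
pose l n := iter n (fun l => next l :: l) [::].
have ol n : onlist (l n) by elim: n => [|n IH] //; exact: hnext.
pose s n := next (l n).
have sl n m : (m < n)%N -> s m \in l n.
  elim: n => // n IH; rewrite ltnS leq_eqVlt inE => /orP[/eqP ->|/IH ->].
    by rewrite eqxx.
  by rewrite orbT.
have lt n m : (m < n)%N -> hdot (s n) (s m) = 0.
  by move=> mn; have [_ _ h _] := ol n.+1; apply: h; exact: sl.
exists s => [n m|n]; last by have [] := ol n.+1.
have [nm|mn|->] := ltngtP n m.
- by apply: hdot_eq0C; exact: lt.
- exact: lt.
- by have [_ h _ _] := ol m.+1.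
Qed.

End Orthonormal.

(** * Maximal families of mutually orthogonal sequences *)

Section MaximalFamily.
Context {R : realType} {H : hilbertType R} (S : set H).
Let E := orthogonal_complement S.

Definition orthofamily (SS : set (nat -> H)) :=
  (forall s n, SS s -> E (s n)) /\ (forall s, SS s -> orthonormal_seq s) /\
  forall s t n m, SS s -> SS t -> s <> t -> hdot (s n) (t m) = 0.

(** Zorn's lemma: an infinite-dimensional uncovered part would contain an orthonormal sequence,
    which could be added to the family. *)
Lemma maximal_orthofamily : exists2 SS, orthofamily SS &
  finite_dimensional (orthogonal_complement
    (S `|` [set x | exists s n, SS s /\ x = s n])).
Proof.
have [F FF totF|SS [oSS mSS]] := @Zorn_bigcup (nat -> H) orthofamily.
  split=> [s n [X FX Xs]|]; first by have [h _] := FF _ FX; exact: h.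
  split=> [s [X FX Xs]|s t n m [X FX Xs] [Y FY Yt] st].
    by have [_ [h _]] := FF _ FX; exact: h.
  have [XY|YX] := totF _ _ FX FY.
    by have [_ [_ h]] := FF _ FY; apply: h => //; exact: XY.
  by have [_ [_ h]] := FF _ FX; apply: h => //; exact: YX.
exists SS => //; apply: contrapT => /infinite_orthonormal [s so sN].
have [h1 [h2 h3]] := oSS.
have sSS t n m : SS t -> hdot (s n) (t m) = 0.
  by move=> SSt; apply: sN; right; exists t, m.
apply: (mSS (SS `|` [set s])).
  split=> [|h]; first by move=> t SSt; left.
  have : SS s by apply: h; right.
  by move=> /(sSS _ 0%N 0%N); rewrite so => /eqP; rewrite oner_eq0.
split=> [t n [SSt|->]|]; first exact: h1.
  by move=> x Sx; apply: sN; left.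
split=> [t [SSt|->]//|t t' n m [SSt|->] [SSt'|->] tt'].
- exact: h2.
- exact: h3.
- by apply: hdot_eq0C; exact: sSS.
- exact: sSS.
- by [].
Qed.

End MaximalFamily.

(** The witness 2^m (2 N + 1) has an odd cofactor. *)
Lemma logn2_frequent (m N : nat) : exists2 n, (N <= n)%N & logn 2 n = m.
Proof.
exists (2 ^ m * (N.*2.+1))%N.
  by rewrite -addnn; have := expn_gt0 2 m; nia.
rewrite lognM ?expn_gt0// pfactorK// lognE /= dvdn2 /= odd_double /=.
by rewrite addn0.
Qed.

(** One step of the geometric tail bound, with slack b p / 8: the factor 1/2 is a generous
    replacement for 1/3. *)
Lemma geo_step {R : realType} (p q b : R) : 0 <= b -> 0 < p ->
  b / 2 * (q - p) + 4^-1 * p * b <= b / 2 * (q - 4^-1 * p).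
Proof.
move=> b0 /ltW p0; rewrite -subr_ge0.
have -> : b / 2 * (q - 4^-1 * p) - (b / 2 * (q - p) + 4^-1 * p * b) =
  b * p / 8 by field.
by rewrite divr_ge0// mulr_ge0.
Qed.

(** * The operators T_n when the complement is infinite-dimensional *)

Section EmbeddedFamily.
Context {R : realType} {H : hilbertType R} (S : set H).
Let E := orthogonal_complement S.
Variables (SS : set (nat -> H)).
Hypothesis oSS : orthofamily S SS.
Let N := orthogonal_complement (S `|` [set x | exists s n, SS s /\ x = s n]).
Hypothesis finN : finite_dimensional N.
Variables (s0 : nat -> H) (SSs0 : SS s0).

Let SSE s n : SS s -> E (s n). Proof. by case: oSS => h _; exact: h. Qed.

Lemma orthofamily_dot s t n m : SS s -> SS t ->
  hdot (s n) (t m) = if `[< s = t >] then (n == m)%:R else 0.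
Proof.
move=> Ss St; have [_ [h1 h2]] := oSS; case: asboolP => [<-|st] //.
  exact: h1.
exact: h2.
Qed.

(** [F] is the double complement, that is the closed span, of the first terms. *)
Let DF := [set d | forall s, SS s -> hdot d (s 0%N) = 0].
Let F := orthogonal_complement DF.

Let F_head s : SS s -> F (s 0%N).
Proof. by move=> Ss d Dd; apply: hdot_eq0C; exact: Dd. Qed.

(* The graph, on the span of the first terms, of the map sending first terms to
   [n]-th terms. *)
Inductive headspan (n : nat) : H -> H -> Prop :=
| headspan0 : headspan n 0 0
| headspanP c s x y : SS s -> headspan n x y ->
    headspan n (c *: s 0%N + x) (c *: s n + y).

Lemma headspan_lin n c x y a b : headspan n x a -> headspan n y b ->
  headspan n (c *: x + y) (c *: a + b).
Proof.
elim=> [|k s x' a' Ss _ IH] h; first by rewrite !scaler0 !add0r.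
by rewrite !scalerDr -!addrA !scalerA; apply: headspanP => //; exact: IH.
Qed.

(** The n-th terms of the sequences are orthonormal just as the first terms are, so the graph is
    isometric; in particular it is single-valued. *)
Lemma headspan_iso n x a y b : headspan n x a -> headspan n y b ->
  hdot a b = hdot x y.
Proof.
elim=> [|k s x' a' Ss _ IH] h; first by rewrite !hdot0l.
rewrite !hdotDl !hdotZl IH//; congr (_ * _ + _).
elim: h => [|k' t y' b' St _ IH']; first by rewrite !hdot0r.
by rewrite !hdotDr !hdotZr IH' !orthofamily_dot// !eqxx.
Qed.

Lemma shift_ex n : exists U : {linear H -> H}, [/\ bounded_by U 1,
  forall s, SS s -> U (s 0%N) = s n,
  forall y t k, F y -> SS t -> hdot (U y) (t k) = (n == k)%:R * hdot y (t 0%N) &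
  forall y, F y -> E (U y)].
Proof.
have [||||U [V [Ub UV UG VG _]]] := @extend_graph _ H H (headspan n) 1.
- exact: headspan0.
- by move=> c x y a b; exact: headspan_lin.
- move=> x a h; rewrite mul1r -(@ler_pXn2r _ 2)// ?nnegrE ?nrm_ge0//.
  by rewrite -!rdotxx /rdot (headspan_iso h h).
- exact: ler01.
have hs s : SS s -> headspan n (s 0%N) (s n).
  by move=> Ss; have := headspanP 1 Ss (headspan0 n); rewrite !scale1r !addr0.
exists U; split=> // [s Ss|y t k Fy St|y Fy d Sd].
- exact/UG/hs.
- rewrite UV; apply/eqP; rewrite -subr_eq0; apply/eqP.
  (* The difference on the right is orthogonal to all first terms, hence lies in [DF], and y in [F]
     is orthogonal to it. *)
  have -> : hdot y (V (t k)) - (n == k)%:R * hdot y (t 0%N) =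
      hdot y (V (t k) - (n == k)%:R *: t 0%N).
    by rewrite hdotBr hdotZr conjC_nat.
  apply: Fy => s Ss; apply: hdot_eq0C.
  rewrite hdotBr hdotZr conjC_nat (VG _ _ _ (hs s Ss)) !orthofamily_dot//.
  by case: asboolP => _; rewrite ?eqxx ?mulr1 ?mulr0 subrr.
- rewrite UV; apply: Fy => s Ss; apply: hdot_eq0C.
  by rewrite (VG _ _ _ (hs s Ss)) (SSE n Ss).
Qed.

(** A finite spanning set of [N] padded with zeros, so that it can be indexed by all naturals like
    the U_k. *)
Lemma remainder_seq_ex : exists f : nat -> H, [/\ forall k, N (f k),
  exists2 M : R, 0 <= M & forall k, nrm (f k) <= M &
  forall x, (forall k, hdot x (f k) = 0) -> forall y, N y -> hdot x y = 0].
Proof.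
have [n [e [eN espan]]] := finN.
exists (fun k => if insub k is Some i then e i else 0); split.
- by move=> k; case: insubP => [i _ _|_]; [exact: eN|exact: orthC0].
- exists (\sum_i nrm (e i)); first by apply: sumr_ge0 => i _; exact: nrm_ge0.
  move=> k; case: insubP => [i _ _|_].
    rewrite (bigD1 i)//= lerDl; apply: sumr_ge0 => j _; exact: nrm_ge0.
  by rewrite nrm0; apply: sumr_ge0 => i _; exact: nrm_ge0.
move=> x xf y /espan [c ->]; rewrite linear_sumr big1// => i _.
have := xf i; rewrite valK => h.
by apply: (etrans (hdotZr _ _ _)); rewrite h mulr0.
Qed.

(* The index of [W] is the 2-adic valuation of [n], so each [W m] occurs infinitely
   often. Pairing [sum_n 4^-n T_n z_n = 0] with the [k]-th term of a sequence bounds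
   the [k]-th coefficient by the later ones, which carry a third of its weight. *)
Lemma embedded_family_ex : exists (T : nat -> {linear H -> H}),
  [/\ exists2 C : R, 0 <= C & forall n, bounded_by (T n) C,
    forall n y, F y -> E (T n y),
    forall x (z : nat -> H),
      (fun n => nrm (z n)) @ \oo --> (0 : R) -> (forall n, F (z n)) ->
      (forall n y, F y -> hdot (z n) y = hdot x (T n y)) ->
      forall e, E e -> hdot x e = 0 &
    weighted_series_injective DF T].
Proof.
have /choice [U hU] n := shift_ex n.
have [f [fN [Mf Mf0 fM] fx]] := remainder_seq_ex.
have NE x : N x -> E x by move=> Nx d Sd; apply: Nx; left.
have Nt x t k : N x -> SS t -> hdot x (t k) = 0.
  by move=> Nx St; apply: Nx; right; exists t, k.
(* Odd indices 2 k + 1 encode U_k and even indices 2 k the rank-one map (. | g) f_k. *)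
pose g := s0 0%N; pose W m y := if odd m then U m./2 y else hdot y g *: f m./2.
have /choice [T TE] n : exists T : {linear H -> H},
    forall y, T y = U n y - W (logn 2 n) y.
  apply: ex_linear => c x y; rewrite /W linearP; case: odd.
    by rewrite linearP /= opprD addrACA scalerBr.
  by rewrite hdotDl hdotZl scalerDl -scalerA opprD addrACA scalerBr.
have g1 : hdot g g = 1.
  by rewrite orthofamily_dot//; case: asboolP => // _; rewrite eqxx.
have ng : nrm g = 1.
  by apply/eqP; rewrite -sqrp_eq1 ?nrm_ge0// -rdotxx /rdot g1.
exists T; split.
- exists (1 + (1 + Mf)); first by rewrite !addr_ge0.
  move=> n y; rewrite TE (le_trans (nrmB _ _))// mulrDl lerD//.
    by have [h _ _ _] := hU n; exact: h.
  rewrite /W; case: odd.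
    have [h _ _ _] := hU (logn 2 n)./2; rewrite (le_trans (h _))//.
    by rewrite ler_wpM2r ?nrm_ge0// lerDl.
  rewrite nrmZ (@le_trans _ _ (nrm y * Mf))//.
    rewrite ler_pM ?cabs_ge0 ?nrm_ge0//.
    by rewrite (le_trans (hdot_le _ _))// ng mulr1.
  by rewrite mulrC ler_wpM2r ?nrm_ge0// lerDr.
- move=> n y Fy; rewrite TE; apply: orthC_B.
    by have [_ _ _ h] := hU n; exact: h.
  rewrite /W; case: odd; first by have [_ _ _ h] := hU (logn 2 n)./2; exact: h.
  by rewrite -[_ *: _]addr0; apply: orthC_lin; [exact/NE/fN|exact: orthC0].
- move=> x z z0 zF zT.
  (* For the infinitely many n of valuation m, (x | W_m s_0) = (x | s_n) - (z_n | s_0), and both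
     terms tend to 0, the first by Bessel. *)
  have W0 m s : SS s -> hdot x (W m (s 0%N)) = 0.
    move=> Ss; apply: cabs0_eq0; apply/eqP.
    rewrite eq_le cabs_ge0 andbT leNgt; apply/negP => c0.
    have so : orthonormal_seq s by have [_ [h _]] := oSS; exact: h.
    have ns k : nrm (s k) = 1.
      by apply/eqP; rewrite -sqrp_eq1 ?nrm_ge0// -rdotxx /rdot so eqxx.
    have lim := cvg0D (bessel_cvg0 x so) z0.
    have p n : 0 <= cabs (hdot x (s n)) + nrm (z n).
      by rewrite addr_ge0 ?cabs_ge0 ?nrm_ge0.
    have [K hK] := (cvg0_eps p).2 lim _ c0.
    have [n Kn nm] := logn2_frequent m K.
    have := hK n Kn; rewrite ltNge => /negP; apply.
    have -> : hdot x (W m (s 0%N)) = hdot x (s n) - hdot (z n) (s 0%N).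
      rewrite zT; last exact: F_head.
      rewrite TE hdotBr nm; have [_ h _ _] := hU n; rewrite h//.
      by rewrite subKr.
    rewrite (le_trans (cabsD _ _))// normcN lerD2l.
    by rewrite (le_trans (hdot_le _ _))// ns mulr1.
  have xs k s : SS s -> hdot x (s k) = 0.
    move=> Ss; have := W0 k.*2.+1 s Ss; rewrite /W /= odd_double /=.
    by rewrite uphalf_double; have [_ h _ _] := hU k; rewrite h.
  have xf k : hdot x (f k) = 0.
    have := W0 k.*2 s0 SSs0; rewrite /W odd_double doubleK -/g g1.
    by rewrite scale1r.
  (* The part of x in [E] is orthogonal to every sequence, so it lies in [N]; being orthogonal to a
     spanning set of [N] as well, it is zero. *)
  have [P [_ PE Px]] := orth_proj S.
  move=> e Ee; rewrite Px//.
  suff -> : P x = 0 by rewrite hdot0l.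
  apply: hdotxx_eq0; apply: fx.
    by move=> k; rewrite -Px//; apply: NE.
  move=> d [Sd|[s [n [Ss ->]]]]; first exact: PE.
  by rewrite -Px ?xs//; exact: SSE.
move=> z zF [M zM] zs.
have key t : SS t -> forall n, hdot (z n) (t 0%N) = 0.
  move=> St; pose ze n := hdot (z n) (t 0%N).
  have nt : nrm (t 0%N) = 1.
    apply/eqP; rewrite -sqrp_eq1 ?nrm_ge0// -rdotxx /rdot orthofamily_dot//.
    by case: asboolP => // _; rewrite eqxx.
  have zeM n : cabs (ze n) <= M.
    by rewrite (le_trans (hdot_le _ _))// nt mulr1.
  (* Pairing with t_k sees U_n only for n = k and W_n only when W_n = U_k; the rank-one maps drop
     out because [N] is orthogonal to the sequences. *)
  have Tt n k : hdot (T n (z n)) (t k) =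
      (n == k)%:R * ze n - (logn 2 n == k.*2.+1)%:R * ze n.
    rewrite TE hdotBl; have [_ _ h _] := hU n; rewrite h //; last exact: zF.
    congr (_ - _).
    rewrite /W; case: ifP => om; last first.
      rewrite hdotZl Nt// mulr0.
      case: eqP om => [->|_ _]; last by rewrite mul0r.
      by rewrite /= odd_double.
    have [_ _ h' _] := hU (logn 2 n)./2; rewrite h' //; last exact: zF.
    congr (_%:R * _); congr nat_of_bool; apply/eqP/eqP => [<-|->].
      by rewrite -[LHS]odd_double_half om.
    by rewrite /= uphalf_double.
  (* Each coefficient will be shown to be at most half of the supremum of all of them, so the
     supremum is 0. *)
  pose B := sup (range (fun n => cabs (ze n))).
  have hB : has_sup (range (fun n => cabs (ze n))).
    by split; [exists (cabs (ze 0%N)), 0%N|exists M => _ [n _ <-]].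
  have zeB n : cabs (ze n) <= B by apply: ub_le_sup; [exact: hB.2|exists n].
  have B0 : 0 <= B by apply: le_trans (zeB 0%N); exact: cabs_ge0.
  have half k : cabs (ze k) <= B / 2.
    have w0 := @weight_gt0 R k.
    rewrite -(ler_pM2l w0).
    pose c n := (weight n)%:C * hdot (T n (z n)) (t k).
    (* The valuation of n > 0 is below n, so W_n = U_k forces n > 2 k + 1: no term precedes the
       k-th, and the k-th has no contribution from W. *)
    have small n : (n < k)%N -> c n = 0.
      move=> nk; rewrite /c Tt ltn_eqF// mul0r sub0r.
      case: eqP => [e|_]; last by rewrite mul0r oppr0 mulr0.
      have n0 : (0 < n)%N by case: n e {nk}.
      have := ltn_logl 2 n0; rewrite e => h; exfalso.
      by move: h nk; rewrite -addnn; lia.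
    have at_k : c k = (weight k)%:C * ze k.
      rewrite /c Tt eqxx mul1r; case: eqP => [e|_]; last by rewrite mul0r subr0.
      have k0 : (0 < k)%N by case: k e {w0 c small}.
      by have := ltn_logl 2 k0; rewrite e => h; exfalso; move: h; rewrite -addnn; lia.
    have after n : (k < n)%N -> cabs (c n) <= weight n * B.
      move=> kn; rewrite /c Tt gtn_eqF// mul0r sub0r.
      rewrite ComplexField.Normc.normcM cabsR ger0_norm ?(ltW (weight_gt0 _))//.
      rewrite ler_wpM2l ?(ltW (weight_gt0 _))// normcN.
      by case: eqP => _; rewrite ?mul1r// mul0r ComplexField.Normc.normc0.
    have part i : cabs (\sum_(n < k.+1 + i) c n - (weight k)%:C * ze k) <=
        B / 2 * (weight k - weight (k + i)).
      elim: i => [|i IH].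
        rewrite !addn0 subrr mulr0 big_ord_recr /= at_k big1 ?add0r.
          by rewrite subrr ComplexField.Normc.normc0.
        by move=> n _; apply: small.
      rewrite addnS big_ord_recr /= addrAC (le_trans (cabsD _ _))//.
      rewrite (le_trans (lerD IH (after _ _)))//; first by rewrite addSn ltnS leq_addr.
      rewrite addSn -addnS addnS [weight (k + i).+1]exprS -/(weight (k + i)).
      by apply: geo_step => //; exact: weight_gt0.
    apply/ler_addgt0Pr => e e0.
    have pc n : 0 <= cabs (\sum_(i < n) c i - 0) by exact: cabs_ge0.
    have [K hK] := (cvg0_eps pc).2 (zs (t k)) e e0.
    have h1 := hK (k.+1 + K)%N (leq_addl _ _); have h2 := part K.
    rewrite subr0 in h1; set Sm := \sum_(_ < _) _ in h1 h2.
    have -> : weight k * cabs (ze k) = cabs ((weight k)%:C * ze k).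
      by rewrite ComplexField.Normc.normcM cabsR ger0_norm// ltW.
    have -> : (weight k)%:C * ze k = Sm - (Sm - (weight k)%:C * ze k) by ring.
    rewrite (le_trans (cabsD _ _))// normcN addrC lerD ?(ltW h1)//.
    rewrite (le_trans h2)// [leRHS]mulrC ler_wpM2l ?divr_ge0//.
    by rewrite gerDl oppr_le0 ltW// weight_gt0.
  have B00 : B <= B / 2.
    by apply: ge_sup => [|_ [n _ <-]]; [exact: hB.1|exact: half].
  have {}B00 : B = 0 by apply/eqP; rewrite eq_le B0 andbT; lra.
  move=> n; apply: cabs0_eq0; apply/eqP; rewrite eq_le cabs_ge0 andbT.
  by rewrite -B00; exact: zeB.
(* Orthogonal to all first terms, z_n lies in [DF] as well as in [F]. *)
move=> n; apply: hdotxx_eq0; apply: hdot_eq0C.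
by apply: (zF n) => t St; exact: key.
Qed.

End EmbeddedFamily.

Lemma orth_proj_id {R : realType} {H : hilbertType R} (S : set H)
    (P : {linear H -> H}) :
  (forall x, orthogonal_complement S (P x)) ->
  (forall x y, orthogonal_complement S y -> hdot x y = hdot (P x) y) ->
  forall y, orthogonal_complement S y -> P y = y.
Proof.
move=> PS Px y Sy; apply/eqP; rewrite eq_sym -subr_eq0; apply/eqP/hdotxx_eq0.
by rewrite {1}hdotBl (Px y) ?subrr//; apply: orthC_B.
Qed.

Lemma orthC_setT {R : realType} {H : hilbertType R} (x : H) :
  orthogonal_complement setT x -> x = 0.
Proof. by move=> h; apply: hdotxx_eq0; exact: h. Qed.

(** * Generation from an operator range *)

Section Generation.
Context {R : realType} {H : hilbertType R} (A : operator H).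
Hypotheses (hA : accretive A) (rgA : operator_range (range_id_plus A)).
Let E := orthogonal_complement (odom A).

Lemma generated_of_operator_range : generated_by_accretive_form A.
Proof.
have [R0 [/bounded_operatorP [M M0 R0b] rgE]] := rgA.
have [P [Pb PE Px]] := orth_proj (odom A).
(* Empty sets make [K] and [F] the whole space; the family is constantly the projection onto [E]. *)
have [||j [a [ja _]]] := @form_of_family_ex _ _ A R0 M hA M0 R0b rgE set0 set0
  (fun=> P) 1 _ ler01 (fun=> Pb) (fun n y _ => PE y).
- by move=> w; exists w.
(* For the constant family (x | e) = (z_n | e) for every n, and z_n tends to 0. *)
- move=> x z z0 _ zP e Ee; rewrite -(orth_proj_id PE Px Ee).
  apply: cabs0_eq0; apply: cvg0_cst.
  apply: squeeze0 (cvg0Z (nrm e) z0) _ => n.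
  by rewrite cabs_ge0 -(zP n e) // mulrC hdot_le.
by exists (l2 (fun n => if n is 0%N then set0 else set0)), j, a.
Qed.

Lemma embedded_of_family (DF : set H) (T : nat -> {linear H -> H}) :
  [/\ exists2 C : R, 0 <= C & forall n, bounded_by (T n) C,
    forall n y, orthogonal_complement DF y -> E (T n y),
    forall x (z : nat -> H), (fun n => nrm (z n)) @ \oo --> (0 : R) ->
      (forall n, orthogonal_complement DF (z n)) ->
      (forall n y, orthogonal_complement DF y -> hdot (z n) y = hdot x (T n y)) ->
      forall e, E e -> hdot x e = 0 &
    weighted_series_injective DF T] ->
  generated_by_embedded_accretive_form A.
Proof.
move=> [[C C0 Tb] TE Tsep Tinj].
have [R0 [/bounded_operatorP [M M0 R0b] rgE]] := rgA.
(* On the complement of its kernel [R0] is injective, and projecting w there does not change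
   [R0 w]. *)
pose DK := [set x | R0 x = 0].
have [|j [a [ja jinj]]] := @form_of_family_ex _ _ A R0 M hA M0 R0b rgE DK DF
  T C _ C0 Tb TE Tsep.
  move=> w; have [P [_ PE Px]] := orth_proj DK.
  exists (P w); first exact: PE.
  have [S [R0S _]] := adjoint_ex M0 R0b.
  apply: hdot_ext => y; rewrite !R0S -Px// => x DKx.
  by rewrite (adjC R0S) DKx hdot0r.
exists (l2 (fun n => if n is 0%N then DK else DF)), j, a; split=> //.
apply: jinj => // w Kw R0w; apply: hdotxx_eq0; exact: Kw.
Qed.

Lemma generated_embedded_of_operator_range :
  E = [set 0] \/ ~ finite_dimensional E ->
  generated_by_embedded_accretive_form A.
Proof.
move=> [E0|Einf].
  have [P [Pb PE _]] := orth_proj (odom A).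
  (* Here [F] is zero, so the z-part of the form space is trivial. *)
  apply: (@embedded_of_family setT (fun=> P)); split.
  - by exists 1.
  - by move=> n y _; exact: PE.
  - by move=> x z _ _ _ e; rewrite E0 => ->; rewrite hdot0r.
  - by move=> z zF _ _ n; exact: orthC_setT.
have [SS oSS finN] := maximal_orthofamily (odom A).
(* An empty family would leave all of [E] uncovered, making it finite-dimensional. *)
have [s0 SSs0] : exists s0, SS s0.
  apply: contrapT => nS; apply: Einf; move: finN; rewrite (_ : [set x | _] = set0).
    by rewrite setU0.
  by apply/seteqP; split=> // x [s [n [Ss _]]]; apply: nS; exists s.
have [T hT] := embedded_family_ex oSS finN SSs0.
exact: embedded_of_family hT.
Qed.

End Generation.

Theorem theorem5p4 (R : realType) (H : hilbertType R) (A : operator H)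
    (hA : accretive A) :
  (generated_by_accretive_form A <-> operator_range (range_id_plus A)) /\
  (operator_range (range_id_plus A) ->
   orthogonal_complement (odom A) = [set 0] \/
     ~ finite_dimensional (orthogonal_complement (odom A)) ->
   generated_by_embedded_accretive_form A).
Proof.
split; first split.
- exact: generated_operator_range.
- exact: generated_of_operator_range.
- exact: generated_embedded_of_operator_range.
Qed.
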